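(* Let $X_1,X_2$ be completely regular spaces and let $H:\mathfrak C[X_1]\times\mathfrak C[X_2]\to[0,+\infty]$ be proper, radially $1$-homogeneous, radially convex and lower semicontinuous. Let $\mu_i\in\mathcal M_+(X_i)$, $i=1,2$, let $\alpha\in\mathfrak H^1(\mu_1,\mu_2)$ be optimal, i.e. $\int H\,d\alpha=\mathcal U_H(\mu_1,\mu_2)$, and suppose that $\int H\,d\alpha<+\infty$. Then $\alpha$ is concentrated on a $\sigma$-compact (thus Borel) radial convex cone $\Gamma\subset\mathfrak C[X_1]\times\mathfrak C[X_2]$ which is $H$-cyclically monotone.
   Context: Completely regular spaces are assumed Hausdorff; $\mathcal M_+(X)$ is the set of finite nonnegative Radon measures on $X$. Cone: $\mathfrak C[X]=(X\times[0,+\infty))/\sim$, where $(x,r)\sim(y,s)$ iff ($x=y$ and $r=s\neq0$) or $r=s=0$; $[x,r]$ is the class of $(x,r)$ and $\mathfrak o=[x,0]$ the vertex. A neighbourhood base at $[x,r]$ with $r>0$ is given by the images of the neighbourhoods of $(x,r)$ in the product topology; at $\mathfrak o$ by the sets $\{[x,r]:0\le r<\varepsilon\}$, $\varepsilon>0$. Products of cones have the product topology. $H$ is proper if not identically $+\infty$; radially $1$-homogeneous if $H([x_1,\lambda r_1],[x_2,\lambda r_2])=\lambda H([x_1,r_1],[x_2,r_2])$ for all $\lambda>0$; radially convex if $(r_1,r_2)\mapsto H([x_1,r_1],[x_2,r_2])$ is convex on $[0,+\infty)^2$ for all $(x_1,x_2)$. $\mathcal U_H(\mu_1,\mu_2):=\inf\{\int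 H\,d\alpha:\alpha\in\mathfrak H^1(\mu_1,\mu_2)\}$, where $\mathfrak H^1(\mu_1,\mu_2)$ is the set of nonnegative finite Radon measures $\alpha$ on $\mathfrak C[X_1]\times\mathfrak C[X_2]$ with $\int(r_1+r_2)\,d\alpha<+\infty$ and $\mu_i(A)=\int_{\{r_i>0,\ x_i\in A\}}r_i\,d\alpha([x_1,r_1],[x_2,r_2])$ for every Borel $A\subset X_i$, $i=1,2$. For $\Gamma\subset\mathfrak C[X_1]\times\mathfrak C[X_2]$ let $\Gamma_{x_1,x_2}=\{(r_1,r_2)\in[0,+\infty)^2:([x_1,r_1],[x_2,r_2])\in\Gamma\}$. $\Gamma$ is a radial convex cone if each section $\Gamma_{x_1,x_2}$ is convex and stable under multiplication by every $\lambda>0$. $\Gamma$ is $H$-cyclically monotone if for every finite family $\{(\mathfrak y_1^i,\mathfrak y_2^i)\}_{i=1}^N\subset\Gamma$ and every permutation $\sigma$ of $\{1,\dots,N\}$ one has $\sum_{i=1}^NH(\mathfrak y_1^i,\mathfrak y_2^i)\le\sum_{i=1}^NH(\mathfrak y_1^i,\mathfrak y_2^{\sigma(i)})$. A measure $\alpha$ is concentrated on a Borel set $\Gamma$ if the complement of $\Gamma$ is $\alpha$-negligible. *)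

(* Defs.v *)
From HB Require Import structures.
From mathcomp Require Import all_boot all_order all_algebra all_fingroup.
From mathcomp Require Import generic_quotient interval_inference.
From mathcomp Require Import all_classical all_reals all_analysis.

Set Implicit Arguments.
Unset Strict Implicit.
Unset Printing Implicit Defensive.

Import Order.TTheory GRing.Theory Num.Theory.
Import numFieldTopology.Exports.
Local Open Scope classical_set_scope.
Local Open Scope ring_scope.
Local Open Scope quotient_scope.

(* [0, +oo[ with the topology induced by R; convertible to {nonneg R}. *)
Definition halfline (R : realType) : Type :=
  initial_topology (fun r : {nonneg R} => r%:num).

HB.instance Definition _ (R : realType) := Topological.on (halfline R).

Section cone.
Variables (R : realType) (X : topologicalType).
Implicit Types p q : X * halfline R.

Definition cone_rel p q : bool :=
  [&& p.1 == q.1, p.2 == q.2 & p.2 != 0%:nng :> {nonneg R}] ||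
  (p.2 == 0%:nng :> {nonneg R}) && (q.2 == 0%:nng :> {nonneg R}).

Lemma cone_rel_refl : reflexive cone_rel.
Proof. by move=> p; rewrite /cone_rel !eqxx /=; case: eqP. Qed.

Lemma cone_rel_sym : symmetric cone_rel.
Proof.
move=> [x r] [y s]; rewrite /cone_rel /= (eq_sym y) (eq_sym s).
by rewrite (andbC (s == _)); case: (r =P s) => [->|]; rewrite ?andbF.
Qed.

Lemma cone_rel_trans : transitive cone_rel.
Proof.
move=> [y s] [x r] [z t]; rewrite /cone_rel /=.
case/orP => [/and3P[/eqP-> /eqP-> s0]|/andP[r0 s0]].
  by rewrite (negbTE s0) !andbT.
by rewrite s0 /= !andbF /= => ->; rewrite r0 orbT.
Qed.

Canonical cone_equiv := EquivRel cone_rel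
  cone_rel_refl cone_rel_sym cone_rel_trans.

Definition cone : Type := {eq_quot cone_equiv}.

HB.instance Definition _ := Choice.on cone.
HB.instance Definition _ := EqQuotient.on cone.

Definition cone_pt (x : X) (r : {nonneg R}) : cone := \pi_cone (x, r).

(* [repr] picks a representative: the radius does not depend on it, and the
   base point does not either when the radius is nonzero. *)
Definition cone_radius (y : cone) : {nonneg R} := (repr y).2.
Definition cone_base (y : cone) : X := (repr y).1.

Lemma repr_cone_rel (p : X * halfline R) : cone_rel (repr (\pi_cone p)) p.
Proof. by have /eqmodP := reprK (\pi_cone p). Qed.

Lemma cone_radiusE x r : cone_radius (cone_pt x r) = r.
Proof.
rewrite /cone_radius /cone_pt; have := repr_cone_rel (x, r).
by case/orP => /= [/and3P[_ /eqP-> _]|/andP[/eqP-> /eqP->]].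
Qed.

Lemma repr_cone_pt x (r : {nonneg R}) : r != 0%:nng ->
  repr (cone_pt x r) = (x, r).
Proof.
rewrite /cone_pt => r0; have := repr_cone_rel (x, r).
rewrite /cone_rel /= (negbTE r0) andbF orbF => /and3P[/eqP xE /eqP rE _].
by rewrite [LHS]surjective_pairing xE rE.
Qed.

Lemma cone_baseE x (r : {nonneg R}) : r != 0%:nng -> cone_base (cone_pt x r) = x.
Proof. by move=> r0; rewrite /cone_base repr_cone_pt. Qed.

(* At the vertex this can be strictly coarser than the quotient topology. *)
Definition cone_nbhs (y : cone) : set_system cone := [set U |
  if cone_radius y == 0%:nng then
    exists2 e : R, 0 < e & [set z | (cone_radius z)%:num < e] `<=` U
  else exists2 N, nbhs (repr y : X * halfline R) N & \pi_cone @` N `<=` U].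

Let radius_continuous : continuous (fun p : X * halfline R => p.2%:num).
Proof.
move=> p; apply: (@cvg_comp _ _ _ snd (fun r : halfline R => r%:num)).
  exact: cvg_snd.
exact: initial_continuous.
Qed.

Let nbhs_pi (x : X) (r : halfline R) (U : set cone) : r != 0%:nng :> {nonneg R} ->
  cone_nbhs (\pi_cone (x, r)) U =
  exists2 N, nbhs ((x, r) : X * halfline R) N & \pi_cone @` N `<=` U.
Proof.
move=> r0; have := cone_radiusE x r; have := repr_cone_pt x r0.
by rewrite /cone_nbhs /cone_pt /= => -> ->; rewrite (negbTE r0).
Qed.

Let cone_nbhs_filter y : ProperFilter (cone_nbhs y).
Proof.
rewrite /cone_nbhs; have [y0|y0] := eqVneq (cone_radius y) 0%:nng.
  apply: Build_ProperFilter_ex.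
    by move=> U [e e0 eU]; exists y; apply: eU; rewrite /= y0.
  split; first by exists 1.
    move=> U V [e e0 eU] [d d0 dV]; exists (Num.min e d).
      by rewrite lt_min e0.
    by move=> z /=; rewrite lt_min => /andP[/eU ? /dV ?].
  by move=> U V UV [e e0 eU]; exists e => //; exact: subset_trans UV.
apply: Build_ProperFilter_ex.
  move=> U [N yN NU]; exists y; apply: NU; exists (repr y).
    exact: nbhs_singleton.
  exact: reprK.
split; first by exists setT => //; exact: filterT.
  move=> U V [N yN NU] [M yM MV]; exists (N `&` M); first exact: filterI.
  by move=> _ [p [Np Mp] <-]; split; [apply: NU|apply: MV]; exists p.
by move=> U V UV [N yN NU]; exists N => //; exact: subset_trans UV.
Qed.

Let cone_nbhs_singleton y (U : set cone) : cone_nbhs y U -> U y.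
Proof.
rewrite /cone_nbhs /=; have [y0|y0] := eqVneq (cone_radius y) 0%:nng.
  by move=> [e e0]; apply; rewrite /= y0.
move=> [N /nbhs_singleton yN]; apply; exists (repr y) => //; exact: reprK.
Qed.

Let cone_nbhs_nbhs y (U : set cone) :
  cone_nbhs y U -> cone_nbhs y (cone_nbhs^~ U).
Proof.
rewrite {1 2}/cone_nbhs /=; have [y0|y0] := eqVneq (cone_radius y) 0%:nng.
  move=> [e e0 eU]; exists e => // z /= ze; rewrite /cone_nbhs /=.
  have [z0|z0] := eqVneq (cone_radius z) 0%:nng; first by exists e.
  exists [set p : X * halfline R | p.2%:num < e].
    apply: (@radius_continuous (repr z) [set s : R | s < e]).
    exact: lt_nbhsl.
  by move=> _ [[x r] re <-]; apply: eU; rewrite /= [cone_radius _]cone_radiusE.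
move=> [N yN NU].
exists (N° `&` [set p : X * halfline R | 0 < p.2%:num]).
  apply: filterI; first exact: nbhs_interior.
  apply: (@radius_continuous (repr y) [set s : R | 0 < s]); apply: lt_nbhsr.
  by rewrite lt_neqAle eq_sym y0 /=.
move=> _ [[x r] [/= Nxr r0] <-]; rewrite nbhs_pi; last first.
  by rewrite -num_eq /= gt_eqF.
by exists N.
Qed.

HB.instance Definition _ := hasNbhs.Build cone cone_nbhs.
HB.instance Definition _ := Nbhs_isNbhsTopological.Build cone
  cone_nbhs_filter cone_nbhs_singleton cone_nbhs_nbhs.

End cone.

HB.instance Definition _ (R : realType) (X : ptopologicalType) :=
  isPointed.Build (cone R X) (cone_pt point 0%:nng).

HB.saturate prod.

(* On a product of spaces this is the Borel sigma-algebra of the product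
   topology, which can be larger than the product sigma-algebra. *)
Definition borelType (T : ptopologicalType) := g_sigma_algebraType (@open T).

Section radon.
Variables (R : realType) (T : ptopologicalType).
Local Open Scope ereal_scope.

(* Only used for finite measures, for which inner regularity with respect to
   compact sets, on all Borel sets, is the whole Radon property. *)
Definition radon (mu : {measure set borelType T -> \bar R}) :=
  forall A, measurable (A : set (borelType T)) -> forall e : R, (0 < e)%R ->
  exists K : set T, [/\ compact K, K `<=` A & mu (A `\` K) <= e%:E].

Definition sigma_compact (A : set T) :=
  exists2 K : (set T)^nat, (forall n, compact (K n)) & A = \bigcup_n K n.

Definition concentrated (mu : {measure set borelType T -> \bar R})
  (A : set T) := measurable (A : set (borelType T)) /\ mu.-negligible (~` A).

End radon.

Section transport.
Variables (R : realType) (X1 X2 : ptopologicalType).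
Implicit Types (H : cone R X1 * cone R X2 -> \bar R).
Implicit Types (Gamma : set (cone R X1 * cone R X2)).
Local Open Scope ereal_scope.

Definition proper_cost H := exists y, H y != +oo.

Definition radially_homogeneous H :=
  forall (x1 : X1) (x2 : X2) (r1 r2 : {nonneg R}) (l : {posnum R}),
  H (cone_pt x1 (l%:num * r1%:num)%:nng%R, cone_pt x2 (l%:num * r2%:num)%:nng%R) =
  l%:num%:E * H (cone_pt x1 r1, cone_pt x2 r2).

(* [t] and [u] may be zero: this adds nothing since 0 * +oo = 0 in [\bar R]. *)
Definition radially_convex H :=
  forall (x1 : X1) (x2 : X2) (r1 r2 s1 s2 t u : {nonneg R}),
  (t%:num + u%:num = 1)%R ->
  H (cone_pt x1 (t%:num * r1%:num + u%:num * s1%:num)%:nng%R,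
     cone_pt x2 (t%:num * r2%:num + u%:num * s2%:num)%:nng%R) <=
  t%:num%:E * H (cone_pt x1 r1, cone_pt x2 r2) +
  u%:num%:E * H (cone_pt x1 s1, cone_pt x2 s2).

(* The 1-homogeneous marginals of [alpha] are [mu1] and [mu2]. *)
Definition homogeneous_plan
    (mu1 : {finite_measure set borelType X1 -> \bar R})
    (mu2 : {finite_measure set borelType X2 -> \bar R})
    (alpha : {finite_measure set borelType (cone R X1 * cone R X2)%type
              -> \bar R}) :=
  [/\ radon alpha,
      \int[alpha]_y ((cone_radius y.1)%:num + (cone_radius y.2)%:num)%:E < +oo,
      forall A, measurable (A : set (borelType X1)) ->
        mu1 A = \int[alpha]_(y in
          [set y | (0 < (cone_radius y.1)%:num)%R /\ A (cone_base y.1)])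
            (cone_radius y.1)%:num%:E &
      forall A, measurable (A : set (borelType X2)) ->
        mu2 A = \int[alpha]_(y in
          [set y | (0 < (cone_radius y.2)%:num)%R /\ A (cone_base y.2)])
            (cone_radius y.2)%:num%:E].

Definition transport_cost H mu1 mu2 : \bar R :=
  ereal_inf [set \int[alpha]_y H y | alpha in homogeneous_plan mu1 mu2].

(* [R^o * R^o] is the real vector space in which [convex_set] is stated; every
   point of the section has nonnegative coordinates. *)
Definition radial_section Gamma (x1 : X1) (x2 : X2) : set (R^o * R^o) :=
  [set (r.1%:num, r.2%:num) | r in
    [set r : {nonneg R} * {nonneg R} |
      Gamma (cone_pt x1 r.1, cone_pt x2 r.2)]].

Definition radial_convex_cone Gamma := forall (x1 : X1) (x2 : X2),
  convex_set (radial_section Gamma x1 x2) /\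
  forall l : R, (0 < l)%R -> forall r, radial_section Gamma x1 x2 r ->
    radial_section Gamma x1 x2 (l *: r)%R.

Definition cyclically_monotone H Gamma :=
  forall (N : nat) (y : 'I_N -> cone R X1 * cone R X2) (s : 'S_N),
  (forall i, Gamma (y i)) ->
  \sum_(i < N) H (y i) <= \sum_(i < N) H ((y i).1, (y (s i)).2).

End transport.

(* Main.v *)
Require Import Defs.
From HB Require Import structures.
From mathcomp Require Import all_boot all_order all_algebra all_fingroup.
From mathcomp Require Import generic_quotient interval_inference ring lra.
From mathcomp Require Import all_classical all_reals all_analysis.
From mathcomp Require Import measurable_realfun.

Set Implicit Arguments.
Unset Strict Implicit.
Unset Printing Implicit Defensive.

Import Order.TTheory GRing.Theory Num.Theory.
Import numFieldTopology.Exports.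
Local Open Scope classical_set_scope.
Local Open Scope ring_scope.
Local Open Scope ereal_scope.

(** The set [Gamma] comes from complementary slackness.

    Suppose that potentials [phi1 n] and [phi2 n] satisfy
    [phi1 n x1 * r1 + phi2 n x2 * r2 <= H ([x1, r1], [x2, r2])], and call
    calibrated the pairs at which the two sides become equal in the limit.
    The left-hand side is linear in the radii, and [H] is subadditive and
    homogeneous in them, so calibrated pairs are stable under sums and
    dilations with fixed base points: they form a radial convex cone.  The
    left-hand side is also a sum of a function of the first point and of a
    function of the second one, so exchanging second points does not change
    its total: calibrated pairs are cyclically monotone.  It remains to
    calibrate almost every pair and to find a sigma-compact radial convex
    cone of full measure inside the calibrated ones.

    Potentials that are optimal up to [2 ^ - n.+1] give almost everywhere
    calibration, because their defects have a finite sum in L1.  Their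
    existence is the absence of a duality gap ([cone_duality],
    [optimal_potentials]), proved over pairs with base points in compact sets
    [B1] and [B2]; countably many such pairs of compact sets carry the plan
    (see [calibrating_potentials]).  If no potential did better than [D],
    Hahn-Banach ([cone_functional]) would give a positive linear functional
    on the functions that are bounded on the compact set of pairs with base
    points in [B1], [B2] and total radius 1; it would have the right marginals
    and be at most [D] on every function below [H].  Its values on indicators are a
    finitely additive measure on all subsets; a Caratheodory construction from
    its values on compact sets ([radon_of_content]) turns it into a Radon
    measure.  On lower semicontinuous functions the integral can only
    decrease, which keeps the cost below [D] and the marginals of open sets
    below the prescribed ones; since the total masses agree, inner regularity
    of the prescribed marginals forces equality ([marginal_unique]).  So a
    plan cheaper than the optimal one would exist.

    Finally, inner regularity gives a sigma-compact set of full measure inside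
    the calibrated pairs, and its convex cone hull remains inside.  The hull is
    sigma-compact since the relation [w = l y + z] is closed
    ([cone_lincomb_closed]) and sums of pairs over compact bases with bounded
    radii stay in a compact set. *)

Local Notation rad y := ((cone_radius y)%:num).

(** * Compact sets in Hausdorff spaces *)

Section compact_sets.
Variable T : topologicalType.

(** The sets satisfying [Q] form an ideal.  If it did not contain [A], the
    complements of its members would generate a proper filter without cluster
    point in [A]. *)
Lemma compact_ind (A : set T) (Q : set T -> Prop) :
  Q set0 -> (forall U V, Q U -> Q V -> Q (U `|` V)) ->
  (forall U V, U `<=` V -> Q V -> Q U) ->
  (forall x, A x -> exists2 U, nbhs x U & Q U) ->
  compact A -> Q A.
Proof.
move=> Q0 QU QS Qloc cA; apply: contrapT => nQA.
pose F : set_system T := [set V | Q (A `\` V)].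
have FF : ProperFilter F.
  split; first by rewrite /F /= setD0.
  split; first by rewrite /F /= setDT.
    by move=> U V FU FV; rewrite /F /= setDIr; exact: QU.
  by move=> U V UV FU; apply: QS FU; exact: setDS.
have FA : F A by rewrite /F /= setDv.
have [x [Ax clx]] := cA F FF FA.
have [U xU QUU] := Qloc x Ax.
have FCU : F (~` U).
  by rewrite /F /=; apply: QS QUU; rewrite setDE setCK; exact: subIsetr.
by have [y []] := clx _ _ FCU xU.
Qed.

Hypothesis hT : hausdorff_space T.

Lemma compact_separation (A B : set T) : compact A -> compact B ->
  A `&` B = set0 -> exists U V, [/\ open U, open V, A `<=` U, B `<=` V
    & U `&` V = set0].
Proof.
move=> cA cB AB0.
pose Q2 (V : set T) := exists V1 U1, [/\ open V1, open U1, V `<=` V1, A `<=` U1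
  & U1 `&` V1 = set0].
suff : Q2 B by move=> [V1 [U1 [*]]]; exists U1, V1.
apply: compact_ind cB.
- exists set0, setT; split=> //; [exact: open0|exact: openT|by rewrite setI0].
- move=> U V [V1 [U1 [oV1 oU1 UV1 AU1 UV0]]] [V2 [U2 [oV2 oU2 UV2 AU2 UV0']]].
  exists (V1 `|` V2), (U1 `&` U2); split.
  + exact: openU.
  + exact: openI.
  + exact: setUSS.
  + by move=> x Ax; split; [exact: AU1|exact: AU2].
  + rewrite -subset0 => x [[x1 x2] [x3|x3]].
      by rewrite -UV0.
    by rewrite -UV0'.
- move=> U V UV [V1 [U1 [? ? ? ? ?]]]; exists V1, U1; split=> //.
  exact: subset_trans UV _.
move=> y By.
pose Q1 (U : set T) := exists V1 U1, [/\ open V1, open U1, V1 y, U `<=` U1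
  & U1 `&` V1 = set0].
suff : Q1 A.
  move=> [V1 [U1 [oV1 oU1 V1y AU1 UV0]]]; exists V1.
    exact: open_nbhs_nbhs.
  by exists V1, U1; split.
apply: compact_ind cA.
- exists setT, set0; split=> //; [exact: openT|exact: open0|by rewrite set0I].
- move=> U V [V1 [U1 [oV1 oU1 UV1 AU1 UV0]]] [V2 [U2 [oV2 oU2 UV2 AU2 UV0']]].
  exists (V1 `&` V2), (U1 `|` U2); split=> //.
  + exact: openI.
  + exact: openU.
  + exact: setUSS.
  + rewrite -subset0 => x [[x1|x1] [x2 x3]].
      by rewrite -UV0.
    by rewrite -UV0'.
- move=> U V UV [V1 [U1 [? ? ? ? ?]]]; exists V1, U1; split=> //.
  exact: subset_trans UV _.
move=> x Ax.
have xy : x != y by apply/eqP => xy; suff : set0 y by []; rewrite -AB0; split=> //;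
  rewrite -xy.
move: hT; rewrite open_hausdorff => /(_ x y xy)[[U V]] /= [xU yV] [oU oV /eqP UV0].
exists U; first by apply: open_nbhs_nbhs; split=> //; exact: set_mem.
by exists V, U; split=> //; exact: set_mem.
Qed.

(** The parts of [C] outside [U] and outside [V] are disjoint compact sets;
    taking disjoint open neighbourhoods of them away from [C], one at a time,
    leaves the two pieces. *)
Lemma compact_setU_split (C U V : set T) : compact C -> open U -> open V ->
  C `<=` U `|` V -> exists C1 C2, [/\ compact C1, compact C2, C1 `<=` U,
    C2 `<=` V & C = C1 `|` C2].
Proof.
move=> cC oU oV CUV.
have cD W : open W -> compact (C `\` W).
  by move=> oW; apply: compact_closedI => //; exact: open_closedC.
have [|||U1 [V1 [oU1 oV1 CU1 CV1 UV0]]] :=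
  @compact_separation (C `\` U) (C `\` V).
- exact: cD.
- exact: cD.
- rewrite -subset0 => x [[Cx nU] [_ nV]]; by case: (CUV x Cx).
exists (C `\` U1), (C `\` V1); split; try exact: cD.
- by move=> x [Cx nU1]; apply: contrapT => nUx; apply: nU1; apply: CU1; split.
- by move=> x [Cx nU1]; apply: contrapT => nUx; apply: nU1; apply: CV1; split.
- apply/seteqP; split=> x; last by case=> -[].
  move=> Cx.
  have [U1x|nU1x] := pselect (U1 x); last by left.
  right; split=> // V1x.
  by suff : set0 x by []; rewrite -UV0.
Qed.

End compact_sets.

(** * Radon measures from finitely additive ones *)

Lemma finite_measure_of d (T : measurableType d) (R : realType)
    (mu : {measure set T -> \bar R}) : mu setT < +oo ->
  exists nu : {finite_measure set T -> \bar R}, forall A, nu A = mu A.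
Proof.
move=> fmu; exists (mfrestr measurableT fmu) => A.
exact: (congr1 _ (setIT A)).
Qed.

Section borel_sets.
Variable T : ptopologicalType.

Lemma open_borel (U : set T) : open U -> measurable (U : set (borelType T)).
Proof. by move=> oU; exact: sub_sigma_algebra. Qed.

Lemma closed_borel (C : set T) : closed C -> measurable (C : set (borelType T)).
Proof.
by move=> cC; rewrite -[C]setCK; apply: measurableC; apply: open_borel; exact: closed_openC.
Qed.

Lemma compact_borel (C : set T) : hausdorff_space T -> compact C ->
  measurable (C : set (borelType T)).
Proof. by move=> hT cC; apply: closed_borel; exact: compact_closed. Qed.

Lemma sigma_compact_borel (A : set T) : hausdorff_space T -> sigma_compact A ->
  measurable (A : set (borelType T)).
Proof.
by move=> hT [K cK ->]; apply: bigcupT_measurable => n; exact: compact_borel.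
Qed.

End borel_sets.

Section content.
Variables (R : realType) (T : ptopologicalType) (nu : set T -> R) (S : set T).
Hypothesis hT : hausdorff_space T.
Hypothesis nu_ge0 : forall A, (0 <= nu A)%R.
Hypothesis nuU : forall A B, A `&` B = set0 -> nu (A `|` B) = (nu A + nu B)%R.
Hypothesis cS : compact S.
Hypothesis nuS : nu (~` S) = 0%R.

Let nu0 : nu set0 = 0%R.
Proof.
have := nuU (setI0 set0); rewrite setU0 => h; lra.
Qed.

Let nuS_le A B : A `<=` B -> (nu A <= nu B)%R.
Proof.
move=> AB; rewrite -(setDUK AB) nuU ?lerDl //.
by rewrite -subset0 => x [Ax [_]].
Qed.

Let nuU_le A B : (nu (A `|` B) <= nu A + nu B)%R.
Proof.
have -> : A `|` B = A `|` (B `\` A).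
  apply/seteqP; split=> x; last by case=> [|[]]; [left|right].
  by have [Ax _|nAx [//|Bx]] := pselect (A x); [left|right].
rewrite nuU; first by rewrite lerD2l; apply: nuS_le; exact: subDsetl.
by rewrite -subset0 => x [Ax [_]].
Qed.

Let inner (U : set T) : \bar R :=
  ereal_sup [set (nu C)%:E | C in [set C | compact C /\ C `<=` U]].

Let inner_ge U C : compact C -> C `<=` U -> (nu C)%:E <= inner U.
Proof. by move=> cC CU; apply: ereal_sup_ubound; exists C. Qed.

Let inner_leP U x : (forall C, compact C -> C `<=` U -> (nu C)%:E <= x) -> inner U <= x.
Proof. by move=> h; apply: ub_ereal_sup => _ [C [cC CU] <-]; exact: h. Qed.

Let inner_ge0 U : 0 <= inner U.
Proof. by rewrite -[0%R]/(0%R%:E) -nu0; apply: inner_ge => //; exact: compact0. Qed.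

Let inner_lenu U : inner U <= (nu U)%:E.
Proof. by apply: inner_leP => C _ CU; rewrite lee_fin nuS_le. Qed.

Let inner_fin U : inner U \is a fin_num.
Proof. by rewrite ge0_fin_numE // (le_lt_trans (inner_lenu U) (ltry _)). Qed.

Let inner_mono U V : U `<=` V -> inner U <= inner V.
Proof. by move=> UV; apply: inner_leP => C cC CU; apply: inner_ge => //;
  exact: subset_trans UV. Qed.

(* Compactness reduces the countable cover to a finite one, which can then be
   split into compact pieces. *)
Let inner_bigcup (U : (set T)^nat) : (forall n, open (U n)) ->
  inner (\bigcup_n U n) <= \sum_(n <oo) inner (U n).
Proof.
move=> oU; apply: inner_leP => C cC CU.
pose Q (V : set T) := exists n, V `<=` \bigcup_(i < n) U i.
have [n Cn] : Q C.
  apply: compact_ind cC; rewrite /Q.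
  - by exists 0%N.
  - move=> V W [n Vn] [m Wm]; exists (maxn n m) => x [/Vn|/Wm] [i /= im Ux];
      exists i => //=; by rewrite leq_max im // orbT.
  - by move=> V W VW [n Wn]; exists n; exact: subset_trans Wn.
  - move=> x /CU [i _ Ux]; exists (U i); first exact: open_nbhs_nbhs.
    by exists i.+1 => y Uy; exists i => //=.
have : (nu C)%:E <= \sum_(0 <= i < n) inner (U i).
  elim: n C cC Cn {CU} => [|n IHn] C cC Cn.
    rewrite big_geq // (_ : C = set0) ?nu0 //.
    by rewrite -subset0 => x /Cn [].
  have [||||C1 [C2 [cC1 cC2 C1U C2U ->]]] :=
      @compact_setU_split _ hT C (\bigcup_(i < n) U i) (U n).
  - exact: cC.
  - exact: bigcup_open.
  - exact: oU.
  - move=> x /Cn [i /=]; rewrite ltnS leq_eqVlt => /orP[/eqP -> Ux|ii Ux]; first by right.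
    by left; exists i.
  rewrite big_nat_recr //= (le_trans (_ : _ <= (nu C1)%:E + (nu C2)%:E)) //.
    by rewrite lee_fin.
  by apply: leeD; [exact: IHn|exact: inner_ge].
move=> /le_trans; apply.
exact: nneseries_lim_ge.
Qed.

Let outer (A : set T) : \bar R :=
  ereal_inf [set inner U | U in [set U | open U /\ A `<=` U]].

Let outer_le A U : open U -> A `<=` U -> outer A <= inner U.
Proof. by move=> oU AU; apply: ereal_inf_lbound; exists U. Qed.

Let outer_open U : open U -> outer U = inner U.
Proof.
move=> oU; apply/eqP; rewrite eq_le outer_le //=.
by apply: le_ereal_inf_tmp => _ [V [oV UV] <-]; exact: inner_mono.
Qed.

Let outer0 : outer set0 = 0.
Proof.
rewrite outer_open; last exact: open0.
by apply/eqP; rewrite eq_le inner_ge0 andbT (le_trans (inner_lenu _)) // nu0.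
Qed.

Let outer_ge0 A : 0 <= outer A.
Proof. by apply: le_ereal_inf_tmp => _ [V _ <-]; exact: inner_ge0. Qed.

Let outer_mono : {homo outer : A B / A `<=` B >-> A <= B}.
Proof.
move=> A B AB; apply: le_ereal_inf_tmp => _ [V [oV BV] <-].
by apply: outer_le => //; exact: subset_trans BV.
Qed.

Let outer_fin A : outer A \is a fin_num.
Proof.
rewrite ge0_fin_numE //; apply: le_lt_trans (outer_le openT (@subsetT _ A)) _.
by rewrite -ge0_fin_numE.
Qed.

Let outer_approx A (e : R) : (0 < e)%R -> exists U, [/\ open U, A `<=` U &
  inner U <= outer A + e%:E].
Proof.
move=> e0; have /(lb_ereal_inf_adherent e0) := outer_fin A.
by move=> [_ [U [oU AU] <-]] /ltW h; exists U.
Qed.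

Let outer_sub : sigma_subadditive outer.
Proof.
move=> A; apply/lee_addgt0Pr => e e0.
rewrite (le_trans _ (epsilon_trick _ _ _)) //; last exact: ltW.
have [U HU] : {U : nat -> set T & forall n, [/\ open (U n), A n `<=` U n &
    inner (U n) <= outer (A n) + (e / (2 ^ n.+1)%:R)%:E]}.
  apply: (@choice _ _ (fun n U => [/\ open U, A n `<=` U & inner U <= _])) => n.
  by apply: outer_approx; rewrite divr_gt0 // ltr0n expn_gt0.
apply: (@le_trans _ _ (inner (\bigcup_n U n))).
  apply: outer_le; first by apply: bigcup_open => n _; have [] := HU n.
  by apply: subset_bigcup => n _; have [] := HU n.
apply: le_trans (inner_bigcup _) _; first by move=> n; have [] := HU n.
by apply: lee_nneseries => // n _; have [] := HU n.
Qed.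

Let mo : {outer_measure set T -> \bar R} :=
  HB.pack outer (isOuterMeasure.Build R T outer outer0 outer_ge0 outer_mono outer_sub).

(* Inside an open [V] containing the test set, a compact [C] in [V `&` U] leaves
   the open set [V `\` C] around [V `\` U]. *)
Let open_cara U : open U -> mo.-caratheodory U.
Proof.
move=> oU; apply: le_caratheodory_measurable => X.
rewrite /mo /=; apply/lee_addgt0Pr => e e0.
have [V [oV XV Ve]] := outer_approx X e0; apply: le_trans Ve.
apply: (@le_trans _ _ (inner (V `&` U) + outer (V `&` ~` U))).
  apply: leeD; last by apply: outer_mono; exact: setSI.
  by rewrite -outer_open; [apply: outer_mono; exact: setSI|exact: openI].
rewrite -leeBrDr //; apply: inner_leP => C cC CVU.
rewrite leeBrDr // addeC -leeBrDr //.
have oVC : open (V `&` ~` C).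
  by apply: openI => //; apply: closed_openC; exact: compact_closed.
apply: (@le_trans _ _ (inner (V `&` ~` C))).
  apply: outer_le => // x [Vx nUx]; split=> // Cx; apply: nUx.
  by have [] := CVU _ Cx.
apply: inner_leP => D cD DVC; rewrite leeBrDr // -EFinD -nuU.
  apply: inner_ge; first exact: compactU.
  by move=> x [/DVC[]|/CVU[]].
by rewrite -subset0 => x [/DVC[]].
Qed.

Let borel_cara (A : set T) : measurable (A : set (borelType T)) -> mo.-caratheodory A.
Proof.
apply: smallest_sub; last exact: open_cara.
split; first exact: caratheodory_measurable_set0.
  by move=> B mB; rewrite setTD; exact: caratheodory_measurable_setC.
exact: caratheodory_measurable_bigcup.
Qed.

Let outer_sigma : semi_sigma_additive (outer : set (borelType T) -> \bar R).
Proof.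
move=> F mF tF mUF.
apply: (@measure_semi_sigma_additive _ (caratheodory_type mo) _ mo) => //.
  by move=> n; exact: borel_cara.
exact: borel_cara.
Qed.

Let mb : {measure set borelType T -> \bar R} :=
  HB.pack (outer : set (borelType T) -> \bar R)
   (isMeasure.Build _ (borelType T) R outer outer0 outer_ge0 outer_sigma).

(** A finitely additive set function need not be regular, but the supremum of
    its values on the compact subsets of an open set is countably subadditive
    and induces an outer measure for which open sets are measurable.  Passing
    to it lowers the value on open sets, and loses no mass because [nu] lives on
    a compact set. *)
Lemma radon_of_content : exists gamma : {finite_measure set borelType T -> \bar R},
  [/\ radon gamma, forall U, open U -> gamma U <= (nu U)%:E,
      gamma setT = (nu setT)%:E & gamma (~` S) = 0].
Proof.
have [|gamma gE] := @finite_measure_of _ _ _ mb.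
  by rewrite /mb /= -ge0_fin_numE.
have gout A : gamma A = outer A by rewrite gE.
have oS : open (~` S) by apply: closed_openC; exact: compact_closed.
have gS : gamma (~` S) = 0.
  rewrite gout; apply/eqP; rewrite eq_le outer_ge0 andbT outer_open //.
  by rewrite (le_trans (inner_lenu _)) // nuS.
exists gamma; split=> //.
- move=> A mA e e0.
  have [U [oU AU Ue]] := outer_approx (~` A) e0.
  exists (S `\` U); split.
  + by apply: compact_closedI => //; exact: open_closedC.
  + by move=> x [Sx nUx]; apply: contrapT => nAx; exact/nUx/AU.
  have mU := open_borel oU.
  apply: (@le_trans _ _ (gamma ((A `&` U) `|` ~` S))).
    apply: le_measure; rewrite ?inE.
    + by apply: measurableD => //; apply: measurableD => //;
        apply: compact_borel.
    + by apply: measurableU; [exact: measurableI|exact: open_borel].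
    + move=> x [Ax nSU]; have [Sx|] := pselect (S x); last by right.
      by left; split=> //; apply: contrapT => nUx; apply: nSU.
  apply: (@le_trans _ _ (gamma (A `&` U) + gamma (~` S))).
    by apply: measureU2; [exact: measurableI|exact: open_borel].
  rewrite gS adde0 -(@leeD2lE _ (gamma (~` A))); last by rewrite gout.
  have mAC : measurable (~` A : set (borelType T)) by exact: measurableC.
  have mAU : measurable (A `&` U : set (borelType T)) by exact: measurableI.
  apply: (@le_trans _ _ (gamma U)); last by rewrite !gout -(outer_open oU) in Ue *.
  have <- : gamma (~` A `|` (A `&` U)) = gamma (~` A) + gamma (A `&` U).
    by apply: measureU => //; rewrite -subset0 => x [nAx []].
  by apply: le_measure; rewrite ?inE //; [exact: measurableU|move=> x [/AU|[]]].
- by move=> U oU; rewrite gout outer_open.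
- rewrite gout outer_open; last exact: openT.
  apply/eqP; rewrite eq_le inner_lenu /=.
  have -> : nu setT = nu S by rewrite -(setUv S) nuU ?nuS ?addr0 // setICr.
  exact: inner_ge.
Qed.

End content.

(** * A Hahn-Banach theorem for cones of constraints *)

Section cone_functional.
Variables (R : realType) (V : lmodType R) (P : set (V * R)) (E : set V).

(** A pair [(f, c)] of [M] stands for the constraint [L f <= c] on an unknown
    linear form [L].  The set is stable under the nonnegative combinations that
    such constraints imply, and consistent: it does not bound [L 0] by a negative
    number. *)
Definition epigraph_cone (M : set (V * R)) := [/\
  forall f g c d, M (f, c) -> M (g, d) -> M (f + g, c + d)%R,
  forall a f c, (0 <= a)%R -> M (f, c) -> M (a *: f, a * c)%R &
  forall c, M (0, c)%R -> (0 <= c)%R].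

Hypothesis coneP : epigraph_cone P.
Hypothesis ED : forall f g, E f -> E g -> E (f + g)%R.
Hypothesis EZ : forall a f, E f -> E (a *: f)%R.
Hypothesis EP : forall f, E f -> exists c, P (f, c).

Let maximal_cone : exists M, [/\ epigraph_cone M, P `<=` M &
  forall B, epigraph_cone B -> M `<=` B -> B `<=` M].
Proof.
have [F FP totF|Q0 [cQ0 maxQ0]] :=
    @Zorn_bigcup (V * R)%type [set Q | epigraph_cone (P `|` Q)].
  have dir u v : (P `|` \bigcup_(X in F) X) u -> (P `|` \bigcup_(X in F) X) v ->
    exists W, [/\ epigraph_cone W, W `<=` P `|` \bigcup_(X in F) X, W u & W v].
    have sub X : F X -> P `|` X `<=` P `|` \bigcup_(X in F) X.
      by move=> FX; apply: setUS => x Xx; exists X.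
    move=> [Pu|[X FX Xu]] [Pv|[Y FY Yv]].
    - by exists P; split=> //; exact: subsetUl.
    - by exists (P `|` Y); split; [exact: FP|exact: sub|left|right].
    - by exists (P `|` X); split; [exact: FP|exact: sub|right|left].
    - have [XY|YX] := totF X Y FX FY.
      + exists (P `|` Y); split; [exact: FP|exact: sub|right|right] => //.
        exact: XY.
      + exists (P `|` X); split; [exact: FP|exact: sub|right|right] => //.
        exact: YX.
  split.
  - by move=> f g c d /dir /[apply] -[W [[WD _ _] + Wf Wg]]; apply; exact: WD.
  - move=> a f c a0 uf; have [W [[_ WZ _] + Wf _]] := dir _ _ uf uf.
    by apply; exact: WZ.
  - move=> c uf; have [W [[_ _ W0] _ Wf _]] := dir _ _ uf uf.
    exact: W0.
exists (P `|` Q0); split; [exact: cQ0|exact: subsetUl|].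
move=> B cB QB x Bx; right; apply: contrapT => nQx; apply: (maxQ0 B).
  split; first by move=> y Qy; apply: QB; right.
  by move=> BQ; apply: nQx; exact: BQ.
rewrite /= (_ : P `|` B = B) //; apply/seteqP; split=> y; last by right.
by case=> // Py; apply: QB; left.
Qed.

(** By Zorn's lemma there is a maximal consistent cone [M] of constraints, and
    the form is the infimum of the bounds in [M].  It is linear because a
    constraint [L x <= c] outside of [M] is inconsistent with it, so that [M]
    contains a bound below [- c] for [- x].  Only the vectors of [E], for which
    bounds exist, are mapped to meaningful values. *)
Lemma cone_functional : exists L : V -> R, [/\
  forall f g, E f -> E g -> L (f + g)%R = (L f + L g)%R,
  forall a f, (0 <= a)%R -> E f -> L (a *: f)%R = (a * L f)%R &
  forall f c, E f -> P (f, c) -> (L f <= c)%R].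
Proof.
have [M [[MD MZ M0] PM maxM]] := maximal_cone.
have M00 x : E x -> M (0, 0)%R.
  by move=> /EP[c /PM /(MZ 0%R)]; rewrite lexx scale0r mul0r; exact.
have ext x c : E x -> ~ M (x, c) -> exists2 d, (d < - c)%R & M (- x, d)%R.
  move=> Ex nM; apply: contrapT => nd; apply: nM.
  pose B : set (V * R) := [set u | exists y e t, [/\ M (y, e), (0 <= t)%R,
    u.1 = (y + t *: x)%R & u.2 = (e + t * c)%R]].
  apply: (maxM B).
  - split.
    + move=> f g c1 c2 [y [e [t [My t0 /= -> ->]]]] [y' [e' [t' [My' t0' /= -> ->]]]].
      exists (y + y')%R, (e + e')%R, (t + t')%R; split.
      * exact: MD.
      * exact: addr_ge0.
      * by rewrite /= scalerDl addrACA.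
      * by rewrite /= mulrDl addrACA.
    + move=> a f d a0 [y [e [t [My t0 /= -> ->]]]].
      exists (a *: y)%R, (a * e)%R, (a * t)%R; split.
      * exact: MZ.
      * exact: mulr_ge0.
      * by rewrite /= scalerDr scalerA.
      * by rewrite /= mulrDr mulrA.
    + move=> d [y [e [t [My t0 /= yt ->]]]]; rewrite leNgt; apply/negP => et.
      have [t00|t_neq0] := eqVneq t 0%R.
        move: yt et My; rewrite t00 scale0r mul0r !addr0 => <- e0 /M0.
        by rewrite leNgt e0.
      have t_gt0 : (0 < t)%R by rewrite lt_neqAle eq_sym t_neq0.
      apply: nd; exists (t^-1 * e)%R.
        by rewrite -ltr_pdivlMl ?invr_gt0 // invrK mulrN -subr_lt0 opprK.
      have -> : (- x = t^-1 *: y)%R.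
        move/eqP: yt; rewrite eq_sym addr_eq0 => /eqP ->.
        by rewrite scalerN scalerA mulVf // scale1r.
      by apply: MZ => //; rewrite invr_ge0.
  - move=> [y e] My; exists y, e, 0%R; split=> //.
      by rewrite scale0r addr0.
    by rewrite mul0r addr0.
  - exists 0%R, 0%R, 1%R; split=> //; first exact: M00 Ex.
      by rewrite /= scale1r add0r.
    by rewrite /= mul1r add0r.
pose L f := inf [set c | M (f, c)].
have EN f : E f -> E (- f)%R by move=> Ef; rewrite -scaleN1r; exact: EZ.
have lbL f : E f -> has_inf [set c | M (f, c)].
  move=> Ef; have [c /PM Mc] := EP Ef; have [d /PM Md] := EP (EN _ Ef).
  split; first by exists c.
  exists (- d)%R => e /= Me; have := MD _ _ _ _ Me Md.
  by rewrite subrr => /M0; lra.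
have Lle f c : E f -> M (f, c) -> (L f <= c)%R.
  by move=> /lbL[_ lb] Mc; exact: ge_inf.
have leL f c : E f -> (forall d, M (f, d) -> (c <= d)%R) -> (c <= L f)%R.
  by move=> /lbL[ne _] h; apply: lb_le_inf.
have LD f g : E f -> E g -> (L (f + g)%R <= L f + L g)%R.
  move=> Ef Eg; rewrite -lerBlDr; apply: (leL) => // c Mc.
  rewrite lerBlDr -lerBlDl; apply: (leL) => // d Md.
  by rewrite lerBlDl; apply: Lle; [exact: ED|exact: MD].
have LN f : E f -> (L (- f)%R <= - L f)%R.
  move=> Ef; apply/ler_addgt0Pr => e e0.
  have nM : ~ M (f, L f - e)%R by move=> /(Lle _ _ Ef); lra.
  have [d de /(Lle _ _ (EN _ Ef)) Ld] := ext _ _ Ef nM.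
  by move: de e0 Ld; lra.
exists L; split.
- move=> f g Ef Eg; apply/eqP; rewrite eq_le LD //=.
  have := LD _ _ (ED Ef Eg) (EN _ Eg); rewrite addrK.
  by have := LN _ Eg; lra.
- move=> a f a0 Ef; have LZ b h : (0 < b)%R -> E h -> (L (b *: h) <= b * L h)%R.
    move=> b0 Eh; rewrite -ler_pdivrMl //; apply: (leL) => // c Mc.
    by rewrite ler_pdivrMl //; apply: Lle; [exact: EZ|apply: MZ => //; exact: ltW].
  have [->|an0] := eqVneq a 0%R.
    rewrite mul0r scale0r; apply/eqP; rewrite eq_le; apply/andP; split.
      by apply: Lle; [rewrite -(scale0r f); exact: EZ|exact: M00 Ef].
    by apply: (leL) => [|d /M0//]; rewrite -(scale0r f); exact: EZ.
  have a_gt0 : (0 < a)%R by rewrite lt_neqAle eq_sym an0.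
  apply/eqP; rewrite eq_le LZ //= -ler_pdivlMl //.
  have := LZ a^-1%R (a *: f); rewrite invr_gt0 scalerA mulVf // scale1r.
  by apply=> //; exact: EZ.
- by move=> f c Ef /PM; exact: Lle.
Qed.

End cone_functional.

(** * Duality over a compact set *)

Lemma lsc_borel (R : realType) (T : ptopologicalType) (f : T -> \bar R) :
  lower_semicontinuous f -> measurable_fun [set: borelType T] f.
Proof.
move=> /lower_semicontinuousP lf.
apply: (measurability _ (ErealGenOInfty.measurableE R)).
move=> _ [_ [a ->]] <-; apply: measurableI => //; apply: open_borel.
by rewrite preimage_itvoy; exact: lf.
Qed.

(** Discrete layer cake: a nonnegative number is at least the number of positive
    integers below it, and exceeds it by at most 1 ([count_floor_ge]). *)
Lemma count_floor_le (R : realType) (x : R) (m : nat) : (0 <= x ->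
  \sum_(0 <= k < m) (k.+1%:R < x)%R%:R <= x)%R.
Proof.
move=> x0; suff : (\sum_(0 <= k < m) (k.+1%:R < x)%R%:R <= Num.min x m%:R)%R.
  by rewrite le_min => /andP[].
elim: m => [|m IHm]; first by rewrite big_geq // le_min x0 lexx.
rewrite big_nat_recr //=; move: IHm; rewrite !le_min => /andP[h1 h2].
have [mx|mx] := ltP m.+1%:R x.
  have h3 : (\sum_(0 <= k < m) (k.+1%:R < x)%R%:R + 1 <= m.+1%:R :> R)%R.
    by rewrite -addn1 natrD lerD2r.
  by rewrite h3 (le_trans h3 (ltW mx)).
by rewrite addr0 h1 (le_trans h2) // ler_nat.
Qed.

Lemma count_floor_ge (R : realType) (x : R) (m : nat) : (x <= m%:R ->
  x <= 1 + \sum_(0 <= k < m) (k.+1%:R < x)%R%:R)%R.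
Proof.
elim: m => [|m IHm] xm; first by rewrite big_geq // addr0 (le_trans xm) // ler01.
rewrite big_nat_recr //=; have [/IHm h|mx] := leP x m%:R.
  by apply: (le_trans h); rewrite addrA lerDl.
rewrite (_ : (\sum_(0 <= k < m) (k.+1%:R < x)%R%:R)%R = m%:R :> R).
  by apply: (le_trans xm); rewrite addrA (addrC 1%R) natr1 lerDl.
elim: m mx {IHm xm} => [|m IHm] mx; first by rewrite big_geq.
rewrite big_nat_recr //= IHm ?mx ?natr1 //.
by apply: le_lt_trans mx; rewrite ler_nat.
Qed.

Section duality.
Variables (R : realType) (T : ptopologicalType) (S : set T).
Variables (Z : set (T -> R)) (I : (T -> R) -> R) (e : T -> R).
Variables (H : T -> \bar R) (D : R).
Hypothesis hT : hausdorff_space T.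
Hypothesis cS : compact S.
Hypothesis ZD : forall f g, Z f -> Z g -> Z (fun y => f y + g y)%R.
Hypothesis ZZ : forall a f, Z f -> Z (fun y => a * f y)%R.
Hypothesis ID : forall f g, Z f -> Z g -> I (fun y => f y + g y)%R = (I f + I g)%R.
Hypothesis IZ : forall a f, Z f -> I (fun y => a * f y)%R = (a * I f)%R.
Hypothesis Ze : Z e.
Hypothesis eS : forall y, S y -> e y = 1%R.
Hypothesis H_ge0 : forall y, 0 <= H y.
Hypothesis H_lsc : lower_semicontinuous H.
Hypothesis dualD : forall f, Z f -> (forall y, S y -> (f y)%:E <= H y) -> (I f <= D)%R.

(* The constraints on the functional: it is below [I f + t * D] on the functions
   bounded on [S] by [f + t * H]. *)
Let P : set ((T -> R^o) * R) := [set fc | exists f t, [/\ Z f, (0 <= t)%R,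
  forall y, S y -> (fc.1 y - f y)%:E <= t%:E * H y & (I f + t * D <= fc.2)%R]].

Let E : set (T -> R^o) := [set f | exists C : R, forall y, S y -> (`|f y : R| <= C)%R].

Let Z0 : Z (fun=> 0%R).
Proof. by rewrite (_ : (fun=> _) = (fun y => 0 * e y)%R); [exact: ZZ|apply/funext => y;
  rewrite mul0r]. Qed.

Let I0 : I (fun=> 0%R) = 0%R.
Proof.
by rewrite (_ : (fun=> _) = (fun y => 0 * e y)%R); [rewrite IZ // mul0r|apply/funext =>
  y; rewrite mul0r].
Qed.

Let D_ge0 : (0 <= D)%R.
Proof. by rewrite -I0; apply: dualD => // y _; exact: H_ge0. Qed.

Let coneP : epigraph_cone P.
Proof.
split.
- move=> f g c d [f' [t [Zf t0 hf hc]]] [g' [u [Zg u0 hg hd]]].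
  exists (fun y => f' y + g' y)%R, (t + u)%R; split.
  + exact: ZD.
  + exact: addr_ge0.
  + move=> y Sy; rewrite (EFinD t u) ge0_muleDl ?lee_fin //.
    rewrite /= (_ : ((f + g) y - _)%R = ((f y - f' y) + (g y - g' y))%R); last first.
      by rewrite addrACA opprD.
    by rewrite EFinD; apply: leeD; [exact: hf|exact: hg].
  + by move: hc hd; rewrite /= ID // mulrDl; lra.
- move=> a f c a0 [f' [t [Zf t0 hf hc]]].
  exists (fun y => a * f' y)%R, (a * t)%R; split.
  + exact: ZZ.
  + exact: mulr_ge0.
  + move=> y Sy; rewrite /= (_ : ((a *: f) y - _)%R = a * (f y - f' y))%R; last first.
      by rewrite mulrBr.
    by rewrite !EFinM -muleA; apply: lee_wpmul2l; [rewrite lee_fin|exact: hf].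
  + by move: hc => /= hc; rewrite IZ // -mulrA -mulrDr ler_wpM2l.
- move=> c [f [t [Zf t0 hf /= hc]]]; apply: le_trans hc.
  (* [t] may vanish: the bound [D] is applied to [- f / (t + u)] with [u] small *)
  apply/ler_addgt0Pl => s s0.
  have D1 : (0 < D + 1)%R by rewrite ltr_wpDl.
  pose u := (s / (D + 1))%R.
  have u0 : (0 < u)%R by rewrite divr_gt0.
  have tu : (0 < t + u)%R by rewrite ltr_wpDl.
  have : (I (fun y => (- (t + u)^-1) * f y)%R <= D)%R.
    apply: dualD; first exact: ZZ.
    move=> y Sy; rewrite mulNr -mulrN EFinM.
    rewrite lee_pdivrMl // (le_trans (_ : _ <= t%:E * H y)) //.
      by have := hf y Sy; rewrite /= sub0r.
    by rewrite lee_wpmul2r // lee_fin lerDl ltW.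
  rewrite IZ // mulNr lerNl ler_pdivlMl //.
  have : (u * D <= s)%R.
    by rewrite /u mulrAC ler_pdivrMr // ler_wpM2l ?(ltW s0) // lerDl.
  lra.
Qed.

Let ED f g : E f -> E g -> E (f + g)%R.
Proof.
move=> [C hC] [C' hC']; exists (C + C')%R => y Sy.
by apply: le_trans (ler_normD _ _) _; apply: lerD; [exact: hC|exact: hC'].
Qed.

Let EZ a f : E f -> E (a *: f)%R.
Proof.
move=> [C hC]; exists (`|a| * C)%R => y Sy.
by rewrite normrM ler_wpM2l //; exact: hC.
Qed.

Let EP (f : T -> R^o) : E f -> exists c, P (f, c).
Proof.
move=> [C hC]; exists (I (fun y => C * e y)%R), (fun y => C * e y)%R, 0%R; split=> //.
- exact: ZZ.
- by move=> y Sy; rewrite mul0e lee_fin eS // mulr1 subr_le0 (le_trans (ler_norm _)) // hC.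
- by rewrite mul0r addr0.
Qed.

Let EB f (C : R) : (forall y, (0 <= f y <= C)%R) -> E f.
Proof. by move=> h; exists C => y _; have /andP[? ?] := h y; rewrite ger0_norm. Qed.

Section functional.
Variable L : (T -> R^o) -> R.
Hypothesis LD : forall f g, E f -> E g -> L (f + g)%R = (L f + L g)%R.
Hypothesis LZ : forall a f, (0 <= a)%R -> E f -> L (a *: f)%R = (a * L f)%R.
Hypothesis LP : forall f c, E f -> P (f, c) -> (L f <= c)%R.

Let E0 : E 0%R.
Proof. by exists 0%R => y _; rewrite normr0. Qed.

Let L0 : L 0%R = 0%R.
Proof. by rewrite -(scale0r (0%R : T -> R^o)) LZ // mul0r. Qed.

Let EN f : E f -> E (- f)%R.
Proof. by move=> Ef; rewrite -scaleN1r; exact: EZ. Qed.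

Let L_mono f g : E f -> E g -> (forall y, S y -> (f y <= g y)%R) -> (L f <= L g)%R.
Proof.
move=> Ef Eg fg; have Efg : E (f - g)%R by apply: ED => //; exact: EN.
rewrite -[f](subrK g) LD // -[leRHS]add0r lerD2r.
apply: LP => //; exists (fun=> 0%R), 0%R; split=> //.
  by move=> y Sy; rewrite mul0e lee_fin subr0 subr_le0; exact: fg.
by rewrite I0 mul0r addr0.
Qed.

Let L_ge0 f : E f -> (forall y, S y -> (0 <= f y)%R) -> (0 <= L f)%R.
Proof. by move=> Ef f0; rewrite -L0; apply: L_mono. Qed.

Let E1 (A : set T) : E \1_A.
Proof. by apply: (@EB _ 1%R) => y; rewrite indicE; case: (_ \in _);
  rewrite ?lexx ?ler01. Qed.

Let nu (A : set T) : R := L \1_A.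

Let nu_ge0 A : (0 <= nu A)%R.
Proof. by apply: L_ge0 => // y _; rewrite indicE ler0n. Qed.

Let nuU A B : A `&` B = set0 -> nu (A `|` B) = (nu A + nu B)%R.
Proof.
move=> AB; rewrite /nu -LD //; congr L; apply/funext => y.
change (\1_(A `|` B) y = \1_A y + \1_B y :> R)%R; rewrite !indicE in_setU.
have [yA|_] := boolP (y \in A); have [yB|_] := boolP (y \in B); rewrite ?addr0 ?add0r //.
suff : set0 y by []; rewrite -AB; split; exact: set_mem.
Qed.

Let nuS : nu (~` S) = 0%R.
Proof.
apply/eqP; rewrite eq_le nu_ge0 andbT -L0; apply: L_mono => // y Sy.
by rewrite indicE memNset //; apply.
Qed.

Let nuT : nu setT = I e.
Proof.
have E1T : E (cst 1%R : T -> R^o) by rewrite -indicT.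
apply/eqP; rewrite eq_le; apply/andP; split.
  apply: LP => //; exists e, 0%R; split=> //; last by rewrite mul0r addr0.
  by move=> y Sy; rewrite mul0e lee_fin indicT eS // subrr.
have : (L (- \1_setT) <= - I e)%R.
  apply: LP; first exact: EN.
  exists (fun y => -1 * e y)%R, 0%R; split=> //; first exact: ZZ.
    move=> y Sy; rewrite mul0e lee_fin eS // mulr1 opprK.
    by rewrite [X in (X + _)%R]/(- \1_setT y)%R indicT addNr.
  by rewrite IZ // mulN1r mul0r addr0.
have : L (\1_setT - (\1_setT : T -> R^o))%R = 0%R by rewrite subrr.
by rewrite LD //; [rewrite /nu; lra|exact: EN].
Qed.

Let Lsum m (U : (set T)^nat) : E (\sum_(0 <= k < m) \1_(U k))%R /\
  L (\sum_(0 <= k < m) \1_(U k))%R = (\sum_(0 <= k < m) nu (U k))%R.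
Proof.
elim: m => [|m [IHE IHL]]; first by rewrite !big_geq.
by rewrite !big_nat_recr //= LD // IHL; split=> //; exact: ED.
Qed.

Section layer_cake.
Variable gamma : {finite_measure set borelType T -> \bar R}.
Hypothesis gamma_nu : forall U, open U -> gamma U <= (nu U)%:E.

(* The error [gamma setT] of the discrete layer cake disappears in [layer_cake]
   by applying this to the multiples of [f]. *)
Let layer_cake1 (f : T -> R) (m : nat) : (forall y, (0 <= f y <= m%:R)%R) ->
  lower_semicontinuous (EFin \o f) ->
  \int[gamma]_y (f y)%:E <= gamma setT + (L f)%:E.
Proof.
move=> fm lf.
have Ef : E f by exact: EB fm.
pose U k := [set y | k.+1%:R < f y]%R.
have oU k : open (U k).
  move/lower_semicontinuousP : lf => /(_ k.+1%:R).
  by congr open; apply/seteqP; split=> y /=; rewrite lte_fin.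
have mU k : measurable (U k : set (borelType T)) by exact: open_borel.
have UE k y : \1_(U k) y = (k.+1%:R < f y)%R%:R :> R.
  by rewrite indicE; congr (_%:R); congr nat_of_bool; apply/idP/idP; rewrite inE.
have mf : measurable_fun [set: borelType T] (EFin \o f) by exact: lsc_borel.
have m1 k : measurable_fun [set: borelType T] (fun y => (\1_(U k) y)%:E : \bar R).
  by apply/measurable_EFinP; exact: measurable_indic.
apply: (@le_trans _ _ (\int[gamma]_y (1 + \sum_(0 <= k < m) (\1_(U k) y)%:E))).
  apply: ge0_le_integral => //.
  - by move=> y _; rewrite lee_fin; have /andP[] := fm y.
  - by apply: emeasurable_funD => //; apply: emeasurable_sum.
  - move=> y _; rewrite sumEFin -EFinD lee_fin.
    under eq_bigr do rewrite UE.
    by apply: count_floor_ge; have /andP[] := fm y.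
rewrite ge0_integralD //; last 2 first.
- by move=> y _; apply: sume_ge0 => k _; rewrite lee_fin indicE ler0n.
- exact: emeasurable_sum.
rewrite integral_cst // mul1e leeD2l //.
rewrite ge0_integral_sum //.
under eq_bigr do rewrite integral_indic // setIT.
apply: (@le_trans _ _ (\sum_(0 <= k < m) (nu (U k))%:E)).
  by apply: lee_sum => k _; exact: gamma_nu.
have [E2 L2] := Lsum m U.
rewrite sumEFin lee_fin -L2; apply: L_mono => // y Sy.
rewrite fct_sumE; under eq_bigr do rewrite UE.
by apply: count_floor_le; have /andP[] := fm y.
Qed.

Let layer_cake (f : T -> R) (m : nat) : (forall y, (0 <= f y <= m%:R)%R) ->
  lower_semicontinuous (EFin \o f) ->
  \int[gamma]_y (f y)%:E <= (L f)%:E.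
Proof.
move=> fm lf.
have Ef : E f by exact: EB fm.
have mf : measurable_fun [set: borelType T] (EFin \o f) by exact: lsc_borel.
have f0 y : (0 <= f y)%R by have /andP[] := fm y.
have h n : n.+1%:R%:E * \int[gamma]_y (f y)%:E <= gamma setT + n.+1%:R%:E * (L f)%:E.
  rewrite -ge0_integralZl_EFin //; last by move=> y _; rewrite lee_fin.
  rewrite -EFinM -LZ //.
  apply: (@layer_cake1 _ (n.+1 * m)).
    move=> y; have /andP[h1 h2] := fm y; apply/andP; split; first exact: mulr_ge0.
    by rewrite natrM ler_pM2l.
  apply/lower_semicontinuousP => a; move/lower_semicontinuousP : lf =>
    /(_ (n.+1%:R^-1 * a)%R).
  by congr open; apply/seteqP; split=> y /=; rewrite !lte_fin ltr_pdivrMl.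
have fin : gamma setT \is a fin_num by exact: fin_num_measure.
have Ifin : \int[gamma]_y (f y)%:E \is a fin_num.
  have := h 0%N; rewrite !mul1e => h0.
  rewrite ge0_fin_numE; last by apply: integral_ge0 => y _; rewrite lee_fin.
  by apply: (le_lt_trans h0); rewrite lte_add_pinfty ?ltry // -ge0_fin_numE.
move: h; rewrite -(fineK fin) -(fineK Ifin) lee_fin => h.
apply/ler_addgt0Pr => s s0.
have [n ns] : exists n, (fine (gamma setT) / s < n%:R)%R.
  by exists (Num.truncn (fine (gamma setT) / s)).+1; exact: truncnS_gt.
have := h n; rewrite -!EFinM -EFinD lee_fin.
have : (fine (gamma setT) <= n.+1%:R * s)%R.
  rewrite -ler_pdivrMr //; apply: (le_trans (ltW ns)).
  by rewrite ler_nat.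
move=> h1 h2.
have : (n.+1%:R * fine (\int[gamma]_y (f y)%:E) <= n.+1%:R * (L f + s))%R.
  by rewrite mulrDr; lra.
by rewrite ler_pM2l.
Qed.

(** The superlevel sets of [f] are open, where [gamma] is below [nu]; this bounds
    the integrals of the truncations of [f] by the values of [L]. *)
Lemma lsc_integral_le (f : T -> \bar R) (c : R) : (forall y, 0 <= f y) ->
  lower_semicontinuous f ->
  (forall g : T -> R, E g -> (forall y, S y -> (g y)%:E <= f y) -> (L g <= c)%R) ->
  \int[gamma]_y f y <= c%:E.
Proof.
move=> f0 lf hc.
pose g n y := mine (f y) n%:R%:E.
have gfin n y : g n y \is a fin_num.
  rewrite ge0_fin_numE; last by rewrite /g le_min f0 lee_fin ler0n.
  by rewrite /g gt_min ltry orbT.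
have g0 n y : (0 <= fine (g n y) <= n%:R)%R.
  by rewrite -!lee_fin fineK // /g le_min f0 lee_fin ler0n /= ge_min lexx orbT.
have lg n : lower_semicontinuous (g n).
  apply/lower_semicontinuousP => a.
  have [an|na] := ltP a n%:R.
    move/lower_semicontinuousP : lf => /(_ a); congr open.
    by apply/seteqP; split=> y /=; rewrite lt_min lte_fin an andbT.
  rewrite (_ : [set _ | _] = set0); first exact: open0.
  by rewrite -subset0 => y /=; rewrite /g lt_min !lte_fin (ltNge a) na andbF.
apply: (@le_trans _ _ (\int[gamma]_y (limn (g^~ y)))).
  rewrite le_eqVlt; apply/orP; left; apply/eqP.
  apply: eq_integral => y _; apply/esym/cvg_lim => //.
  have := f0 y; rewrite /g; case: (f y) => [r r0|_|//].
    apply: cvg_near_cst; exists (Num.truncn r).+1 => //= n /= rn.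
    apply: min_l; rewrite lee_fin; apply: (le_trans (ltW (truncnS_gt r))).
    by rewrite ler_nat.
  apply/cvgeyPge => A; exists (Num.truncn A).+1 => //= n /= An.
  rewrite le_min leey lee_fin; apply: (le_trans (ltW (truncnS_gt A))).
  by rewrite ler_nat.
have mg n : measurable_fun [set: borelType T] (g n) by exact: lsc_borel.
have gg0 n y : 0 <= g n y by rewrite /g le_min f0 lee_fin ler0n.
have gm y n m : (n <= m)%N -> g n y <= g m y.
  by move=> nm; rewrite /g le_min !ge_min lexx /= lee_fin ler_nat nm orbT.
have cv := @cvg_monotone_convergence _ _ _ gamma _ measurableT g mg
  (fun n y _ => gg0 n y) (fun y _ n m => @gm y n m).
rewrite -(cvg_lim _ cv) //.
apply: lime_le; first exact: cvgP cv.
apply: nearW => n.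
rewrite (_ : (fun y => _) = EFin \o (fine \o g n)); last by apply/funext => y /=;
  rewrite fineK.
apply: le_trans (layer_cake (g0 n) _) _.
  by rewrite (_ : _ \o _ = g n) //; apply/funext => y /=; rewrite fineK.
rewrite lee_fin; apply: hc; first by exact: EB (g0 n).
by move=> y _; rewrite fineK // ge_min lexx.
Qed.

End layer_cake.

Lemma functional_measure : exists mu : {finite_measure set borelType T -> \bar R},
  [/\ radon mu, mu (~` S) = 0, mu setT = (I e)%:E &
  forall U, open U -> mu U <= (nu U)%:E].
Proof.
have [mu [rmu muU muT muS]] := radon_of_content hT nu_ge0 nuU cS nuS.
by exists mu; split=> //; rewrite muT nuT.
Qed.

Lemma functional_plan : exists mu : {finite_measure set borelType T -> \bar R},
  [/\ radon mu, mu (~` S) = 0, mu setT = (I e)%:E,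
  \int[mu]_y H y <= D%:E & forall f, Z f -> (forall y, (0 <= f y)%R) ->
    lower_semicontinuous (EFin \o f) -> \int[mu]_y (f y)%:E <= (I f)%:E].
Proof.
have [mu [rmu muS muT muU]] := functional_measure.
exists mu; split=> //.
- apply: lsc_integral_le => // g Eg gH; apply: LP => //.
  exists (fun=> 0%R), 1%R; split=> //; last by rewrite I0 mul1r add0r.
  by move=> y Sy; rewrite subr0 mul1e; exact: gH.
- move=> f Zf f0 lf; apply: lsc_integral_le => // g Eg gf; apply: LP => //.
  exists f, 0%R; split=> //; last by rewrite mul0r addr0.
  by move=> y Sy; rewrite mul0e lee_fin subr_le0 -lee_fin; exact: gf.
Qed.

End functional.

(** Absence of a duality gap for a linear space [Z] of test functions with a
    linear form [I] on it.  If [D] bounds [I f] for the test functions [f] below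
    [H] on [S], then a measure on [S] has cost at most [D].  It need not represent
    [I]: it is only below [I] on lower semicontinuous test functions, with the same
    total mass, since [e] is 1 on [S]. *)
Theorem compact_duality : exists mu : {finite_measure set borelType T -> \bar R},
  [/\ radon mu, mu (~` S) = 0, mu setT = (I e)%:E,
  \int[mu]_y H y <= D%:E & forall f, Z f -> (forall y, (0 <= f y)%R) ->
    lower_semicontinuous (EFin \o f) -> \int[mu]_y (f y)%:E <= (I f)%:E].
Proof.
have [L [LD LZ LP]] := cone_functional coneP ED EZ EP.
exact: (@functional_plan L).
Qed.

End duality.

(** * The topology of the cone *)

Local Close Scope ereal_scope.

Section cone_topology.
Variables (R : realType) (X : ptopologicalType).
Implicit Types (x : X) (r : {nonneg R}) (y z : cone R X).

Lemma cone_ptK y : cone_pt (cone_base y) (cone_radius y) = y.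
Proof. by rewrite /cone_pt /cone_base /cone_radius -surjective_pairing reprK. Qed.

Lemma cone_pt0 x x' : cone_pt x 0%:nng = cone_pt x' 0%:nng :> cone R X.
Proof. by apply/eqmodP; rewrite /= /cone_rel /= !eqxx orbT. Qed.

Lemma cone_radius_eq0 y : (cone_radius y == 0%:nng) = (rad y == 0)%R.
Proof. by rewrite -num_eq. Qed.

Lemma cone_rad0 x y : rad y = 0%R -> y = cone_pt x 0%:nng.
Proof.
move=> /eqP; rewrite -cone_radius_eq0 => /eqP y0.
by rewrite -(cone_ptK y) y0; exact: cone_pt0.
Qed.

Lemma cone_rad_gt0 y : rad y <> 0 -> 0 < rad y.
Proof. by move=> y0; rewrite lt_neqAle eq_sym andbC ge0 /=; apply/eqP. Qed.

Lemma nbhs_vertex y (U : set (cone R X)) : rad y = 0%R ->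
  nbhs y U <-> exists2 e : R, (0 < e)%R & [set z | (rad z < e)%R] `<=` U.
Proof.
move=> /eqP; rewrite -cone_radius_eq0 => y0.
by rewrite [nbhs y U]/(cone_nbhs y U) /cone_nbhs /= y0.
Qed.

Lemma nbhs_cone_pt x r (U : set (cone R X)) : (0 < r%:num)%R ->
  nbhs (cone_pt x r) U <->
  exists2 N, nbhs ((x, r) : X * halfline R) N & (fun p : X * halfline R =>
    cone_pt p.1 p.2) @` N `<=` U.
Proof.
move=> r0; have rn : r != 0%:nng by rewrite -num_eq gt_eqF.
rewrite [nbhs _ U]/(cone_nbhs _ U) /cone_nbhs /= cone_radiusE (negbTE rn).
rewrite repr_cone_pt //; split=> -[N xN NU]; exists N => // _ [[x' r'] Np <-];
  by apply: NU; exists (x', r').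
Qed.

Lemma halfline_num_continuous : continuous (fun r : halfline R => r%:num).
Proof. exact: initial_continuous. Qed.

Lemma snd_num_continuous : continuous (fun p : X * halfline R => p.2%:num).
Proof.
move=> p; apply: (@cvg_comp _ _ _ snd (fun r : halfline R => r%:num)).
  exact: cvg_snd.
exact: halfline_num_continuous.
Qed.

Lemma max0_ge0 (r : R) : 0 <= Num.max r 0.
Proof. by rewrite le_max lexx orbT. Qed.

Definition nneg_part (r : R) : halfline R := NngNum (max0_ge0 r).

Lemma nneg_part_continuous : continuous nneg_part.
Proof.
apply: continuous_comp_initial => r.
by apply: (@continuous_max _ _ (fun x : R => x) (cst 0)); [exact: cvg_id|exact: cvg_cst].
Qed.

Lemma cone_radius_continuous : continuous (fun y : cone R X => rad y).
Proof.
move=> y; have [y0|y0] := eqVneq (rad y) 0.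
  move=> U; rewrite y0 => /nbhs_ballP[e /= e0 eU]; apply/(nbhs_vertex _ y0).
  exists e => // z /= ze; apply: eU.
  by rewrite /ball /= sub0r normrN ger0_norm.
have {y0} y0 : 0 < rad y by rewrite lt_neqAle eq_sym y0 /=.
move=> U yU; rewrite -(cone_ptK y); apply/nbhs_cone_pt => //.
exists [set p : X * halfline R | U p.2%:num].
  exact: (@snd_num_continuous (_, _) _ yU).
by move=> _ [[x r] /= Ur <-]; rewrite /= cone_radiusE.
Qed.

Lemma cone_pt_continuous :
  continuous (fun p : X * halfline R => cone_pt p.1 p.2).
Proof.
move=> [x r] U /=; have [r0|r0] := eqVneq (r%:num) 0.
  move=> /nbhs_vertex; rewrite cone_radiusE => /(_ r0) [e e0 eU].
  have : nbhs ((x, r) : X * halfline R) [set p | p.2%:num < e].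
    by apply: (@snd_num_continuous (x, r) [set s | s < e]); apply: lt_nbhsl; rewrite /= r0.
  by apply: filterS => -[x' r'] /= r'e; apply: eU; rewrite /= cone_radiusE.
have {r0} r0 : 0 < r%:num by rewrite lt_neqAle eq_sym r0 /=.
move=> /(nbhs_cone_pt _ _ r0)[N xN NU].
by apply: filterS xN => p Np; apply: NU; exists p.
Qed.

Lemma cone_base_continuous y : 0 < rad y ->
  {for y, continuous (@cone_base R X)}.
Proof.
move=> y0 U yU; rewrite -[y]cone_ptK; apply/nbhs_cone_pt => //.
exists ([set p : X * halfline R | U p.1] `&` [set p | 0 < p.2%:num]).
  apply: filterI; first by apply: (@cvg_fst _ _ (nbhs (cone_base y))).
  by apply: (@snd_num_continuous (_, _) [set s | 0 < s]); exact: lt_nbhsr.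
move=> _ [[x r] [/= Ux r0] <-] /=; rewrite cone_baseE //.
by rewrite -num_eq gt_eqF.
Qed.

Lemma radius_gt0_open (a : R) : open [set y : cone R X | a < rad y].
Proof.
by apply: (@open_comp _ _ (fun y : cone R X => rad y) [set s | a < s]);
  [move=> y _; exact: cone_radius_continuous|exact: open_gt].
Qed.

Lemma base_open (U : set X) : open U ->
  open [set y : cone R X | 0 < rad y /\ U (cone_base y)].
Proof.
move=> oU; rewrite openE => y [y0 Uy]; apply: filterI.
  have := @radius_gt0_open 0; rewrite openE => /(_ y y0); exact.
apply: (cone_base_continuous y0); exact: open_nbhs_nbhs.
Qed.

Hypothesis hX : hausdorff_space X.

Lemma cone_hausdorff : hausdorff_space (cone R X).
Proof.
move=> y z cl; apply: contrapT => yz.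
have radyz : rad y = rad z.
  apply: (@Rhausdorff R) => A B yA zB.
  have [w [wA wB]] := cl _ _ (cone_radius_continuous yA) (cone_radius_continuous zB).
  by exists (rad w).
have [y0|y0] := eqVneq (rad y) 0.
  apply: yz; rewrite (cone_rad0 (cone_base z) y0); apply/esym.
  by apply: cone_rad0; rewrite -radyz.
have {y0} y0 : 0 < rad y by rewrite lt_neqAle eq_sym y0 /=.
have z0 : 0 < rad z by rewrite -radyz.
apply: yz; rewrite -(cone_ptK y) -(cone_ptK z).
have -> : cone_radius y = cone_radius z by apply/val_inj.
congr cone_pt; apply: hX => A B yA zB.
have [w [wA wB]] := cl _ _ (cone_base_continuous y0 yA) (cone_base_continuous z0 zB).
by exists (cone_base w).
Qed.

(** The vertex has no base point of its own, hence the first alternative. *)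
Definition cone_over (B : set X) : set (cone R X) :=
  [set y | rad y = 0 \/ B (cone_base y)].

(** Away from the vertex this is the image of the product of [B] and an interval;
    bounding the radius makes it compact even though the base point is lost at
    the vertex. *)
Lemma cone_over_compact (B : set X) (M : R) : compact B ->
  compact (cone_over B `&` [set y | rad y <= M]).
Proof.
move=> cB; have [M0|M0] := ltP M 0.
  rewrite (_ : _ `&` _ = set0); first exact: compact0.
  by rewrite -subset0 => y [_ /=]; rewrite leNgt (lt_le_trans M0).
pose f (p : X * R) : cone R X := cone_pt p.1 (nneg_part p.2).
have cf : continuous f.
  move=> p; apply: (@continuous_comp _ _ _ 
    (fun p : X * R => (p.1, nneg_part p.2))
    (fun p : X * halfline R => cone_pt p.1 p.2)); last exact: cone_pt_continuous.
  have c2 : continuous (fun q : X * R => nneg_part q.2).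
    move=> q; apply: (@cvg_comp _ _ _ snd nneg_part); first exact: cvg_snd.
    exact: nneg_part_continuous.
  have c1 : continuous (fun q : X * R => q.1) by move=> q; exact: cvg_fst.
  exact: (cvg_pair (c1 p) (c2 p)).
rewrite (_ : _ `&` _ = f @` (B `*` `[0, M]) `|` [set cone_pt point 0%:nng]).
  apply: compactU; last exact: compact_set1.
  apply: continuous_compact; first exact: continuous_subspaceT.
  apply: compact_setX => //; exact: segment_compact.
apply/seteqP; split=> y.
  move=> [[y0|By] yM]; first by right; rewrite (cone_rad0 point y0).
  left; exists (cone_base y, rad y) => /=.
    by split=> //=; rewrite in_itv /= yM andbT.
  rewrite /f /= -[RHS]cone_ptK; congr cone_pt; apply/val_inj => /=.
  by rewrite max_l.
move=> [[[x r] /= [Bx]]|->]; last by split; [left|]; rewrite /= cone_radiusE.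
rewrite in_itv /= => /andP[r0 rM] <-; split; last by rewrite /= cone_radiusE /= max_l.
have [r00|r00] := eqVneq r 0; first by left; rewrite cone_radiusE /= r00 maxxx.
right; rewrite /f cone_baseE //= -num_eq /= max_l //.
Qed.

Lemma same_base_closed : closed [set p : cone R X * cone R X |
  [\/ rad p.1 = 0, rad p.2 = 0 | cone_base p.1 = cone_base p.2]].
Proof.
rewrite -[X in closed X]setCK; apply: open_closedC.
rewrite openE => -[y z] /= nyz.
have y0 : rad y <> 0 by move=> e; apply: nyz; exact: Or31.
have z0 : rad z <> 0 by move=> e; apply: nyz; exact: Or32.
have yz : cone_base y <> cone_base z by move=> e; apply: nyz; exact: Or33.
have {}y0 := cone_rad_gt0 y0.
have {}z0 := cone_rad_gt0 z0.
have /eqP yz' := yz.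
move: hX; rewrite open_hausdorff => /(_ _ _ yz')[[U V]] /= [yU zV] [oU oV /eqP UV0].
exists ([set y : cone R X | 0 < rad y /\ U (cone_base y)],
        [set y : cone R X | 0 < rad y /\ V (cone_base y)]).
  split; apply: open_nbhs_nbhs; split.
  - exact: base_open.
  - by split=> //; exact: set_mem.
  - exact: base_open.
  - by split=> //; exact: set_mem.
move=> [y' z'] /= [[y'0 Uy'] [z'0 Vz']] [e|e|e].
- by rewrite e ltxx in y'0.
- by rewrite e ltxx in z'0.
- by suff : set0 (cone_base y') by []; rewrite -UV0; split=> //; rewrite e.
Qed.

End cone_topology.

Local Open Scope ereal_scope.

(** * Borel sets of the cone and homogeneous marginals *)

Section integral_restriction.
Variables (d : measure_display) (T : measurableType d) (R : realType).

Lemma null_set_integral (mu : {measure set T -> \bar R}) (N : set T) (f : T -> \bar R) :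
  measurable N -> mu N = 0 -> (forall x, 0 <= f x) -> measurable_fun setT f ->
  \int[mu]_(x in N) f x = 0.
Proof.
move=> mN N0 f0 mf.
transitivity (\int[mu]_(x in N) `|f x|).
  by apply: eq_integral => x _; rewrite gee0_abs.
apply: integral_abs_eq0 => //; exact: measurable_funTS.
Qed.

Lemma ge0_integral_setTD (mu : {measure set T -> \bar R}) (D : set T) (f : T -> \bar R) :
  measurable D -> (forall x, 0 <= f x) -> measurable_fun setT f ->
  \int[mu]_x f x = \int[mu]_(x in D) f x + \int[mu]_(x in ~` D) f x.
Proof.
move=> mD f0 mf; rewrite -(setUv D) ge0_integral_setU //.
- exact: measurableC.
- by rewrite setUv.
- by apply/disj_setPS; rewrite setICr.
Qed.

Lemma ge0_integral_mrestr (mu : {measure set T -> \bar R}) (D : set T)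
    (mD : measurable D) (f : T -> \bar R) :
  (forall x, 0 <= f x) -> measurable_fun setT f ->
  \int[mrestr mu mD]_x f x = \int[mu]_(x in D) f x.
Proof.
move=> f0 mf; have mDC : measurable (~` D) by exact: measurableC.
pose m1 : {measure set T -> \bar R} := mrestr mu mD.
pose m2 : {measure set T -> \bar R} := mrestr mu mDC.
have mfD : measurable_fun D f by exact: measurable_funTS.
have -> : \int[mu]_(x in D) f x = \int[measure_add m1 m2]_(x in D) f x.
  apply: eq_measure_integral => A mA _.
  apply: (etrans _ (esym (measure_addE m1 m2 A))).
  rewrite /m1 /m2 /= /mrestr -measureU; first by rewrite -setIUr setUv setIT.
  - exact: measurableI.
  - exact: measurableI.
  - by rewrite setIACA setICr setI0.
rewrite ge0_integral_measure_add //.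
rewrite (@ge0_integral_setTD m1 D) // [X in _ + X = _]null_set_integral //; last first.
  by rewrite /m1 /= /mrestr setICl measure0.
rewrite [X in _ = _ + X]null_set_integral //.
by rewrite /m2 /= /mrestr setICr measure0.
Qed.

End integral_restriction.

Section marginal_comparison.
Variables (R : realType) (X : ptopologicalType) (m m' : set X -> \bar R).
Hypothesis hX : hausdorff_space X.
Hypothesis m_ge0 : forall A, 0 <= m A.
Hypothesis m'_ge0 : forall A, 0 <= m' A.
Hypothesis mU : forall A B, measurable (A : set (borelType X)) ->
  measurable (B : set (borelType X)) -> A `&` B = set0 -> m (A `|` B) = m A + m B.
Hypothesis m'U : forall A B, measurable (A : set (borelType X)) ->
  measurable (B : set (borelType X)) -> A `&` B = set0 -> m' (A `|` B) = m' A + m' B.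
Hypothesis mT : m setT = m' setT.
Hypothesis m'T : m' setT < +oo.
Hypothesis m_le : forall U, open U -> m U <= m' U.
Hypothesis m'_reg : forall A, measurable (A : set (borelType X)) ->
  forall e : R, (0 < e)%R -> exists K, [/\ compact K, K `<=` A & m' (A `\` K) <= e%:E].

Let mono (f : set X -> \bar R) A B : (forall A, 0 <= f A) ->
  (forall A B, measurable (A : set (borelType X)) ->
  measurable (B : set (borelType X)) -> A `&` B = set0 -> f (A `|` B) = f A + f B) ->
  measurable (A : set (borelType X)) -> measurable (B : set (borelType X)) ->
  A `<=` B -> f A <= f B.
Proof.
move=> f0 fU mA mB AB; rewrite -(setDUK AB) fU ?leeDl //; first exact: measurableD.
by rewrite -subset0 => x [? []].
Qed.

Let m'fin A : measurable (A : set (borelType X)) -> m' A \is a fin_num.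
Proof.
move=> mA; rewrite ge0_fin_numE //; apply: le_lt_trans m'T.
by apply: mono => //; exact: measurableT.
Qed.

Let mfin A : measurable (A : set (borelType X)) -> m A \is a fin_num.
Proof.
move=> mA; rewrite ge0_fin_numE //; apply: le_lt_trans m'T; rewrite -mT.
by apply: mono => //; exact: measurableT.
Qed.

Let complement A : measurable (A : set (borelType X)) ->
  m A + m (~` A) = m' A + m' (~` A).
Proof.
move=> mA; rewrite -mU ?setICr -?m'U ?setICr ?setUv //; exact: measurableC.
Qed.

Let ge_m' A : measurable (A : set (borelType X)) -> m' A <= m A.
Proof.
move=> mA; apply/lee_addgt0Pr => e e0.
have [K [cK KA AKe]] := m'_reg mA e0.
have mK : measurable (K : set (borelType X)) by exact: compact_borel.
have mKC : measurable (~` K : set (borelType X)) by exact: measurableC.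
have KK : m' K <= m K.
  rewrite -(leeD2rE _ _ (m'fin mKC)) -complement // leeD2l //.
  by apply: m_le; apply: closed_openC; exact: compact_closed.
rewrite -{1}(setDUK KA) m'U //; first by apply: leeD => //; apply: (le_trans KK);
  exact: mono.
- exact: measurableD.
- by rewrite -subset0 => x [? []].
Qed.

(** A set function below [m'] on open sets is above it on closed sets if the total
    masses agree, hence above it on all Borel sets by inner regularity; the
    complement gives the other inequality. *)
Lemma marginal_unique A : measurable (A : set (borelType X)) -> m A = m' A.
Proof.
move=> mA; apply/eqP; rewrite eq_le ge_m' // andbT.
have mAC : measurable (~` A : set (borelType X)) by exact: measurableC.
rewrite -(leeD2rE _ _ (mfin mAC)) complement // leeD2l //; exact: ge_m'.
Qed.

End marginal_comparison.

Section cone_measurability.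
Variables (R : realType) (X : ptopologicalType).
Implicit Types (y : cone R X).

Lemma cone_base_borel (A : set X) : measurable (A : set (borelType X)) ->
  measurable ([set y | (0 < rad y)%R /\ A (cone_base y)] : set (borelType (cone R X))).
Proof.
pose G := [set A | measurable ([set y | (0 < rad y)%R /\ A (cone_base y)] :
  set (borelType (cone R X)))].
suff : <<s open >> `<=` G by apply.
apply: smallest_sub.
  split.
  - by rewrite /G /= (_ : [set _ | _] = set0) //; rewrite -subset0 => y [].
  - move=> B mB; rewrite /G /= (_ : [set y | _] =
    [set y | (0 < rad y)%R] `\` [set y | (0 < rad y)%R /\ B (cone_base y)]).
      by apply: measurableD => //; apply: open_borel; exact: radius_gt0_open.
    apply/seteqP; split=> y /= [y0 h]; split=> //; first by move=> [_]; case: h.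
    by split=> // By; apply: h.
  - move=> F mF; rewrite /G /= (_ : [set y | _] =
    \bigcup_i [set y | (0 < rad y)%R /\ F i (cone_base y)]).
      exact: bigcupT_measurable.
    apply/seteqP; split=> y /=.
      by move=> [y0 [i _ Fi]]; exists i.
    by move=> [i _ [y0 Fi]]; split=> //; exists i.
move=> U oU; apply: open_borel; exact: base_open.
Qed.

End cone_measurability.

Lemma continuous_borel_fun (T U : ptopologicalType) (p : T -> U) :
  continuous p -> measurable_fun [set: borelType T] (p : borelType T -> borelType U).
Proof.
move=> cp; apply: (@measurability _ _ (borelType T) (borelType U) setT p open) => //.
move=> _ [B oB <-]; rewrite setTI; apply: open_borel.
by apply: open_comp => // y _; exact: cp.
Qed.

Section weighted_marginal.
Variables (R : realType) (X T : ptopologicalType) (p : T -> cone R X).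
Hypothesis cp : continuous p.

(** Its integral is the homogeneous marginal of [A] ([marginal_densityE]).  It is
    lower semicontinuous when [A] is open: the factor [rad] makes up for the base
    point being lost at the vertex. *)
Definition marginal_density (A : set X) (y : T) : R :=
  (\1_A (cone_base (p y)) * rad (p y))%R.

Lemma marginal_density_ge0 A y : (0 <= marginal_density A y)%R.
Proof. by rewrite mulr_ge0 // indicE ler0n. Qed.

Lemma marginal_density_gtE A (a : R) : (0 <= a)%R ->
  [set y | (a < marginal_density A y)%R] =
  [set y | (a < rad (p y))%R] `&` p @^-1` [set z | (0 < rad z)%R /\ A (cone_base z)].
Proof.
move=> a0; apply/seteqP; split=> y /=; rewrite /marginal_density indicE.
  have [|_] := boolP (_ \in _); last by rewrite mul0r ltNge a0.
  rewrite inE mul1r => Ay ar; split=> //; split=> //; exact: le_lt_trans ar.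
by move=> [ar [_ Ay]]; rewrite mem_set // mul1r.
Qed.

Lemma marginal_density_gtT A (a : R) : (a < 0)%R ->
  [set y | (a < marginal_density A y)%R] = setT.
Proof.
move=> a0; apply/seteqP; split=> y //= _.
exact: lt_le_trans (marginal_density_ge0 A y).
Qed.

Let radp_open (a : R) : open [set y | (a < rad (p y))%R].
Proof.
apply: (@open_comp _ _ p [set z | (a < rad z)%R]); first by move=> y _; exact: cp.
exact: radius_gt0_open.
Qed.

Lemma marginal_density_measurable A : measurable (A : set (borelType X)) ->
  measurable_fun [set: borelType T] (EFin \o marginal_density A).
Proof.
move=> mA; apply: (measurability _ (ErealGenOInfty.measurableE R)).
move=> _ [_ [a ->]] <-; rewrite setTI preimage_itvoy.
rewrite (_ : [set _ | _] = [set y | (a < marginal_density A y)%R]); last first.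
  by apply/seteqP; split=> y /=; rewrite lte_fin.
have [a0|a0] := ltP a 0%R; first by rewrite marginal_density_gtT.
rewrite marginal_density_gtE //; apply: measurableI; first exact: open_borel.
rewrite -[X in measurable X]setTI; apply: (continuous_borel_fun cp) => //.
exact: cone_base_borel.
Qed.

Lemma marginal_density_lsc U : open U -> lower_semicontinuous (EFin \o marginal_density U).
Proof.
move=> oU; apply/lower_semicontinuousP => a.
rewrite (_ : [set _ | _] = [set y | (a < marginal_density U y)%R]); last first.
  by apply/seteqP; split=> y /=; rewrite lte_fin.
have [a0|a0] := ltP a 0%R; first by rewrite marginal_density_gtT //; exact: openT.
rewrite marginal_density_gtE //; apply: openI => //.
by apply: open_comp; [move=> y _; exact: cp|exact: base_open].
Qed.

Lemma marginal_densityE (mu : {measure set borelType T -> \bar R}) (A : set X) :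
  \int[mu]_(y in [set y | (0 < rad (p y))%R /\ A (cone_base (p y))]) (rad (p y))%:E =
  \int[mu]_y (marginal_density A y)%:E.
Proof.
rewrite integral_mkcond; apply: eq_integral => y _; rewrite patchE.
case: ifPn => [|]; rewrite /marginal_density indicE.
  by rewrite inE => -[_ Ay]; rewrite mem_set // mul1r.
rewrite notin_setE /= => h; have [|_] := boolP (_ \in _); last by rewrite mul0r.
rewrite inE mul1r => Ay; have [->//|r0] := eqVneq (rad (p y)) 0%R.
by exfalso; apply: h; split=> //; apply: cone_rad_gt0; apply/eqP.
Qed.

Lemma marginal_densityU A B y : A `&` B = set0 ->
  marginal_density (A `|` B) y = (marginal_density A y + marginal_density B y)%R.
Proof.
move=> AB; rewrite /marginal_density -mulrDl; congr (_ * _)%R; rewrite !indicE in_setU.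
have [yA|_] := boolP (_ \in A); have [yB|_] := boolP (_ \in B); rewrite ?addr0 ?add0r //.
suff : set0 (cone_base (p y)) by []; rewrite -AB; split; exact: set_mem.
Qed.

Lemma marginal_densityT y : marginal_density setT y = rad (p y).
Proof. by rewrite /marginal_density indicT mul1r. Qed.

Lemma marginal_density_le A y : (marginal_density A y <= rad (p y))%R.
Proof. by rewrite ler_piMl // indicE lern1 leq_b1. Qed.

Lemma integral_marginal_densityU (mu : {measure set borelType T -> \bar R})
    (D : set T) (A B : set X) :
  measurable (D : set (borelType T)) ->
  measurable (A : set (borelType X)) -> measurable (B : set (borelType X)) ->
  A `&` B = set0 ->
  \int[mu]_(y in D) (marginal_density (A `|` B) y)%:E =
  \int[mu]_(y in D) (marginal_density A y)%:E + \int[mu]_(y in D) (marginal_density B y)%:E.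
Proof.
move=> mD mA mB AB; rewrite -ge0_integralD //.
- by apply: eq_integral => y _; rewrite -EFinD marginal_densityU.
- by move=> y _; rewrite lee_fin marginal_density_ge0.
- by apply: measurable_funTS; exact: marginal_density_measurable.
- by move=> y _; rewrite lee_fin marginal_density_ge0.
- by apply: measurable_funTS; exact: marginal_density_measurable.
Qed.

Lemma integral_marginal_density_ge0 (mu : {measure set borelType T -> \bar R})
    (D : set T) (A : set X) : 0 <= \int[mu]_(y in D) (marginal_density A y)%:E.
Proof. by apply: integral_ge0 => y _; rewrite lee_fin marginal_density_ge0. Qed.

End weighted_marginal.

(** * Duality for homogeneous plans *)

Lemma continuous_lsc (R : realType) (T : topologicalType) (f : T -> R) :
  continuous f -> lower_semicontinuous (EFin \o f).
Proof.
move=> cf; apply/lower_semicontinuousP => a.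
rewrite (_ : [set _ | _] = f @^-1` [set r | (a < r)%R]); last first.
  by apply/seteqP; split=> y /=; rewrite lte_fin.
by apply: open_comp; [move=> y _; exact: cf|exact: open_gt].
Qed.

Lemma prod_hausdorff (T U : topologicalType) : hausdorff_space T ->
  hausdorff_space U -> hausdorff_space (T * U)%type.
Proof.
move=> hT hU [x u] [y v] cl; congr pair.
  apply: hT => A B xA yB.
  have [|[z w] [/= zA zB]] := cl [set p | A p.1] [set p | B p.1] _ (@cvg_fst _ _ (nbhs
    y) (nbhs v) _ _ yB).
    exact: (@cvg_fst _ _ (nbhs x) (nbhs u) _ _ xA).
  by exists z.
apply: hU => A B uA vB.
have [|[z w] [/= zA zB]] := cl [set p | A p.2] [set p | B p.2] _ (@cvg_snd _ _ (nbhs y)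
  (nbhs v) _ _ vB).
  exact: (@cvg_snd _ _ (nbhs x) (nbhs u) _ _ uA).
by exists w.
Qed.

Section cone_duality.
Variables (R : realType) (X1 X2 : ptopologicalType).
Let Y : ptopologicalType := (cone R X1 * cone R X2)%type.
Hypotheses (hX1 : hausdorff_space X1) (hX2 : hausdorff_space X2).

Definition potential (phi1 : X1 -> R) (phi2 : X2 -> R) (y : Y) : R :=
  (phi1 (cone_base y.1) * rad y.1 + phi2 (cone_base y.2) * rad y.2)%R.

Lemma cone_pair_hausdorff : hausdorff_space Y.
Proof. by apply: prod_hausdorff; exact: cone_hausdorff. Qed.

Definition cone_product (B1 : set X1) (B2 : set X2) : set Y :=
  [set y | cone_over B1 y.1 /\ cone_over B2 y.2].

(** By homogeneity, an inequality between a potential and the cost over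
    [cone_product B1 B2] only has to hold on this compact slice. *)
Definition cone_simplex (B1 : set X1) (B2 : set X2) : set Y :=
  cone_product B1 B2 `&` [set y | rad y.1 + rad y.2 = 1]%R.

Lemma fst_continuous : continuous (fst : Y -> cone R X1).
Proof. by move=> y; exact: cvg_fst. Qed.

Lemma snd_continuous : continuous (snd : Y -> cone R X2).
Proof. by move=> y; exact: cvg_snd. Qed.

Lemma rad1_continuous : continuous (fun y : Y => rad y.1).
Proof.
by move=> y; apply: (@continuous_comp _ _ _ fst (fun z : cone R X1 => rad z));
  [exact: fst_continuous|exact: cone_radius_continuous].
Qed.

Lemma rad2_continuous : continuous (fun y : Y => rad y.2).
Proof.
by move=> y; apply: (@continuous_comp _ _ _ snd (fun z : cone R X2 => rad z));
  [exact: snd_continuous|exact: cone_radius_continuous].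
Qed.

Lemma cone_product_bounded_compact B1 B2 (M : R) : compact B1 -> compact B2 ->
  compact (cone_product B1 B2 `&` [set y | rad y.1 <= M /\ rad y.2 <= M]%R).
Proof.
move=> cB1 cB2; have := compact_setX (@cone_over_compact R X1 B1 M cB1)
  (@cone_over_compact R X2 B2 M cB2).
by congr compact; apply/seteqP; split=> -[y z] /=;
  [move=> [[? ?] [? ?]]|move=> [[? ?] [? ?]]].
Qed.

Lemma cone_simplex_compact B1 B2 : compact B1 -> compact B2 ->
  compact (cone_simplex B1 B2).
Proof.
move=> cB1 cB2; have -> : cone_simplex B1 B2 =
    (cone_product B1 B2 `&` [set y | rad y.1 <= 1 /\ rad y.2 <= 1]%R) `&`
    [set y | rad y.1 + rad y.2 = 1]%R.
  apply/seteqP; split=> y /=; last by move=> [[]].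
  move=> [yB y1]; split=> //; split=> //; split; rewrite -y1 /=.
    by rewrite lerDl.
  by rewrite lerDr.
apply: compact_closedI; first exact: cone_product_bounded_compact.
apply: (@closed_comp _ _ (fun y : Y => rad y.1 + rad y.2)%R [set 1%R]).
  by move=> y _; apply: cvgD; [exact: rad1_continuous|exact: rad2_continuous].
exact: closed_eq.
Qed.

Variable H : Y -> \bar R.
Hypothesis H_ge0 : forall y, 0 <= H y.
Hypothesis H_lsc : lower_semicontinuous H.
Variables (alpha : {measure set borelType Y -> \bar R}) (W : set Y).
Hypothesis mW : measurable (W : set (borelType Y)).
Hypothesis alpha_fin : \int[alpha]_(y in W) (rad y.1 + rad y.2)%:E < +oo.
Variables (B1 : set X1) (B2 : set X2).
Hypotheses (cB1 : compact B1) (cB2 : compact B2).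

Definition admissible (phi1 : X1 -> R) (phi2 : X2 -> R) := [/\
  alpha.-integrable W (EFin \o (fun y => phi1 (cone_base y.1) * rad y.1)%R),
  alpha.-integrable W (EFin \o (fun y => phi2 (cone_base y.2) * rad y.2)%R)
  & forall y, cone_simplex B1 B2 y -> (potential phi1 phi2 y)%:E <= H y].

Definition inner_regular_marginal (X : ptopologicalType) (p : Y -> cone R X) :=
  forall A, measurable (A : set (borelType X)) -> forall e : R, (0 < e)%R ->
  exists K, [/\ compact K, K `<=` A &
    \int[alpha]_(y in W) (marginal_density p (A `\` K) y)%:E <= e%:E].

Hypothesis reg1 : inner_regular_marginal fst.
Hypothesis reg2 : inner_regular_marginal snd.

Notation total_rad := (fun y : Y => rad y.1 + rad y.2)%R.

Let rad_measurable : [/\ measurable_fun [set: borelType Y] (EFin \o total_rad),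
  measurable_fun [set: borelType Y] (fun y : Y => (rad y.1)%:E) &
  measurable_fun [set: borelType Y] (fun y : Y => (rad y.2)%:E)].
Proof.
split; apply: lsc_borel; apply: continuous_lsc;
  [|exact: rad1_continuous|exact: rad2_continuous].
by move=> y; apply: cvgD; [exact: rad1_continuous|exact: rad2_continuous].
Qed.

Let marginal_integrable (X : ptopologicalType) (p : Y -> cone R X) A : continuous p ->
  (forall y, rad (p y) <= rad y.1 + rad y.2)%R ->
  measurable (A : set (borelType X)) ->
  alpha.-integrable W (EFin \o marginal_density p A).
Proof.
have [m12 _ _] := rad_measurable.
move=> cp pe mA; apply/integrableP; split.
  by apply: measurable_funTS; exact: marginal_density_measurable.
apply: le_lt_trans alpha_fin; apply: ge0_le_integral => //.
- apply: measurable_funTS; apply: measurableT_comp => //.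
  exact: marginal_density_measurable.
- exact: measurable_funTS.
- move=> y _ /=; rewrite lee_fin ger0_norm ?marginal_density_ge0 //.
  exact: le_trans (marginal_density_le _ _ _) (pe y).
Qed.

Let le1 (y : Y) : (rad y.1 <= rad y.1 + rad y.2)%R. Proof. by rewrite lerDl. Qed.
Let le2 (y : Y) : (rad y.2 <= rad y.1 + rad y.2)%R. Proof. by rewrite lerDr. Qed.

Let Z : set (Y -> R) := [set f | exists phi1 phi2, [/\ f = potential phi1 phi2,
  alpha.-integrable W (EFin \o (fun y => phi1 (cone_base y.1) * rad y.1)%R) &
  alpha.-integrable W (EFin \o (fun y => phi2 (cone_base y.2) * rad y.2)%R)]].

Let I (f : Y -> R) : R := (\int[alpha]_(y in W) f y)%R.

Let Z_integrable f : Z f -> alpha.-integrable W (EFin \o f).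
Proof.
move=> [phi1 [phi2 [-> i1 i2]]].
by apply: eq_integrable (integrableD mW i1 i2).
Qed.

Let IE f : Z f -> (I f)%:E = \int[alpha]_(y in W) (f y)%:E.
Proof.
by move=> Zf; rewrite /I /Rintegral fineK //; apply: integrable_fin_num => //;
  exact: Z_integrable.
Qed.

Let ZD f g : Z f -> Z g -> Z (fun y => f y + g y)%R.
Proof.
move=> [phi1 [phi2 [-> i1 i2]]] [psi1 [psi2 [-> j1 j2]]].
exists (fun x => phi1 x + psi1 x)%R, (fun x => phi2 x + psi2 x)%R; split.
- by apply/funext => y; rewrite /potential; ring.
- by apply: eq_integrable (integrableD mW i1 j1) => // y _; rewrite /= -EFinD mulrDl.
- by apply: eq_integrable (integrableD mW i2 j2) => // y _; rewrite /= -EFinD mulrDl.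
Qed.

Let ZZ a f : Z f -> Z (fun y => a * f y)%R.
Proof.
move=> [phi1 [phi2 [-> i1 i2]]].
exists (fun x => a * phi1 x)%R, (fun x => a * phi2 x)%R; split.
- by apply/funext => y; rewrite /potential; ring.
- by apply: eq_integrable (integrableZl mW a i1) => // y _; rewrite /= -EFinM mulrA.
- by apply: eq_integrable (integrableZl mW a i2) => // y _; rewrite /= -EFinM mulrA.
Qed.

Let ID f g : Z f -> Z g -> I (fun y => f y + g y)%R = (I f + I g)%R.
Proof. by move=> Zf Zg; rewrite /I RintegralD //; exact: Z_integrable. Qed.

Let IZ a f : Z f -> I (fun y => a * f y)%R = (a * I f)%R.
Proof. by move=> Zf; rewrite /I RintegralZl //; exact: Z_integrable. Qed.

Let Z1 A : measurable (A : set (borelType X1)) -> Z (marginal_density fst A).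
Proof.
move=> mA; exists (\1_A), (fun=> 0%R); split.
- by apply/funext => y; rewrite /potential mul0r addr0.
- exact: marginal_integrable fst_continuous le1 mA.
- rewrite (_ : EFin \o _ = cst 0%E); first exact: integrable0.
  by apply/funext => y; rewrite /= mul0r.
Qed.

Let Z2 A : measurable (A : set (borelType X2)) -> Z (marginal_density snd A).
Proof.
move=> mA; exists (fun=> 0%R), (\1_A); split.
- by apply/funext => y; rewrite /potential mul0r add0r.
- rewrite (_ : EFin \o _ = cst 0%E); first exact: integrable0.
  by apply/funext => y; rewrite /= mul0r.
- exact: marginal_integrable snd_continuous le2 mA.
Qed.

Let Ztotal : Z total_rad.
Proof.
have -> : total_rad = (fun y =>
  marginal_density fst setT y + marginal_density snd setT y)%R.
  by apply/funext => y; rewrite !marginal_densityT.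
apply: ZD; [exact: Z1|exact: Z2].
Qed.

(** The densities of the marginals of Borel sets are test functions, and those of
    open sets are lower semicontinuous, so [compact_duality] gives marginals below
    the prescribed ones on open sets.  The two total masses add up to the mass of
    [gamma] on the slice of total radius 1, so they agree with the prescribed
    ones, and [marginal_unique] applies. *)
Lemma cone_duality (D : R) :
  (forall phi1 phi2, admissible phi1 phi2 ->
     \int[alpha]_(y in W) potential phi1 phi2 y <= D)%R ->
  exists gamma : {finite_measure set borelType Y -> \bar R}, [/\
    radon gamma, \int[gamma]_y (rad y.1 + rad y.2)%:E < +oo,
    forall A, measurable (A : set (borelType X1)) ->
      \int[gamma]_y (marginal_density fst A y)%:E =
      \int[alpha]_(y in W) (marginal_density fst A y)%:E,
    forall A, measurable (A : set (borelType X2)) ->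
      \int[gamma]_y (marginal_density snd A y)%:E =
      \int[alpha]_(y in W) (marginal_density snd A y)%:E &
    \int[gamma]_y H y <= D%:E].
Proof.
move=> dualD; have hY := cone_pair_hausdorff.
have cS := cone_simplex_compact cB1 cB2.
have [||gamma [rg gS gT gH gle]] :=
  @compact_duality R Y (cone_simplex B1 B2) Z I total_rad H D
   hY cS ZD ZZ ID IZ Ztotal _ H_ge0 H_lsc.
- by move=> y [].
- by move=> f [phi1 [phi2 [-> i1 i2]]] fH; apply: dualD; split.
have [m12 m1 m2] := rad_measurable.
have gle1 U : open U -> \int[gamma]_y (marginal_density fst U y)%:E <=
    \int[alpha]_(y in W) (marginal_density fst U y)%:E.
  move=> oU; rewrite -IE; last by apply: Z1; exact: open_borel.
  apply: gle; first by apply: Z1; exact: open_borel.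
    by move=> y; exact: marginal_density_ge0.
  exact: (marginal_density_lsc fst_continuous).
have gle2 U : open U -> \int[gamma]_y (marginal_density snd U y)%:E <=
    \int[alpha]_(y in W) (marginal_density snd U y)%:E.
  move=> oU; rewrite -IE; last by apply: Z2; exact: open_borel.
  apply: gle; first by apply: Z2; exact: open_borel.
    by move=> y; exact: marginal_density_ge0.
  exact: (marginal_density_lsc snd_continuous).
have totE (mu : {measure set borelType Y -> \bar R}) D' : measurable (D' :
  set (borelType Y)) ->
   \int[mu]_(y in D') (rad y.1 + rad y.2)%:E =
   \int[mu]_(y in D') (marginal_density fst setT y)%:E + \int[mu]_(y in D')
     (marginal_density snd setT y)%:E.
  move=> mD'; rewrite -ge0_integralD //.
  - by apply: eq_integral => y _; rewrite !marginal_densityT EFinD.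
  - by move=> y _; rewrite lee_fin marginal_density_ge0.
  - by apply: measurable_funTS; exact: (marginal_density_measurable fst_continuous).
  - by move=> y _; rewrite lee_fin marginal_density_ge0.
  - by apply: measurable_funTS; exact: (marginal_density_measurable snd_continuous).
have mS : measurable (cone_simplex B1 B2 : set (borelType Y)) by exact: compact_borel.
have gtot : \int[alpha]_(y in W) (rad y.1 + rad y.2)%:E <= \int[gamma]_y (rad y.1 + rad
  y.2)%:E.
  rewrite -(IE Ztotal) -gT.
  have -> : gamma setT = gamma (cone_simplex B1 B2).
    have : gamma (cone_simplex B1 B2 `|` ~` cone_simplex B1 B2) =
        gamma (cone_simplex B1 B2) + gamma (~` cone_simplex B1 B2).
      by apply: measureU; [exact: mS|exact: measurableC|rewrite setICr].
    by rewrite setUv gS adde0.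
  rewrite -(setIT (cone_simplex B1 B2)) -(integral_indic gamma measurableT mS).
  apply: ge0_le_integral => //.
  - by apply/measurable_EFinP; exact: measurable_indic.
  - move=> y _; rewrite lee_fin indicE; have [|_] := boolP (_ \in _); last
    by rewrite addr_ge0.
    by rewrite inE => -[_ /= ->].
move: gtot; rewrite !totE // => gtot.
have fin1 : \int[alpha]_(y in W) (marginal_density fst setT y)%:E \is a fin_num.
  by rewrite -IE //; exact: Z1.
have fin2 : \int[alpha]_(y in W) (marginal_density snd setT y)%:E \is a fin_num.
  by rewrite -IE //; exact: Z2.
have gE1 : \int[gamma]_y (marginal_density fst setT y)%:E =
  \int[alpha]_(y in W) (marginal_density fst setT y)%:E.
  apply/eqP; rewrite eq_le; apply/andP; split; first by apply: gle1; exact: openT.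
  rewrite -(leeD2rE _ _ fin2).
  by apply: (le_trans gtot); rewrite leeD2l // gle2 //; exact: openT.
have gE2 : \int[gamma]_y (marginal_density snd setT y)%:E =
  \int[alpha]_(y in W) (marginal_density snd setT y)%:E.
  apply/eqP; rewrite eq_le; apply/andP; split; first by apply: gle2; exact: openT.
  rewrite -(leeD2lE _ _ fin1).
  by apply: (le_trans gtot); rewrite leeD2r // gle1 //; exact: openT.
exists gamma; split=> //.
- by rewrite totE // gE1 gE2 -totE.
- move=> A; apply: (@marginal_unique R X1
   (fun A => \int[gamma]_y (marginal_density fst A y)%:E)
   (fun A => \int[alpha]_(y in W) (marginal_density fst A y)%:E)) => //.
  + by move=> B; exact: integral_marginal_density_ge0.
  + by move=> B; exact: integral_marginal_density_ge0.
  + by move=> B C mB mC BC; rewrite (integral_marginal_densityU fst_continuous).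
  + by move=> B C mB mC BC; rewrite (integral_marginal_densityU fst_continuous).
  + by rewrite -ge0_fin_numE //; exact: integral_marginal_density_ge0.
- move=> A; apply: (@marginal_unique R X2
   (fun A => \int[gamma]_y (marginal_density snd A y)%:E)
   (fun A => \int[alpha]_(y in W) (marginal_density snd A y)%:E)) => //.
  + by move=> B; exact: integral_marginal_density_ge0.
  + by move=> B; exact: integral_marginal_density_ge0.
  + by move=> B C mB mC BC; rewrite (integral_marginal_densityU snd_continuous).
  + by move=> B C mB mC BC; rewrite (integral_marginal_densityU snd_continuous).
  + by rewrite -ge0_fin_numE //; exact: integral_marginal_density_ge0.
Qed.

End cone_duality.

(** * Almost optimal potentials for an optimal plan *)

Section measure_sum.
Variables (R : realType) (T : ptopologicalType).
Variables (gamma alpha : {finite_measure set borelType T -> \bar R}) (N : set T).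
Hypothesis hT : hausdorff_space T.
Hypothesis mN : measurable (N : set (borelType T)).

(** Completes a competitor [gamma] for the part of [alpha] outside of [N] by the
    rest of [alpha]. *)
Lemma measure_paste : exists beta : {finite_measure set borelType T -> \bar R},
  (radon gamma -> radon alpha -> radon beta) /\
  forall f : T -> \bar R, (forall y, 0 <= f y) -> measurable_fun [set: borelType T] f ->
    \int[beta]_y f y = \int[gamma]_y f y + \int[alpha]_(y in N) f y.
Proof.
pose alphaN : {measure set borelType T -> \bar R} := mrestr alpha mN.
have betaE A : measure_add gamma alphaN A = gamma A + alpha (A `&` N).
  exact: measure_addE.
have [|beta bE] := @finite_measure_of _ _ _ (measure_add gamma alphaN).
  apply: (@le_lt_trans _ _ (gamma setT + alpha (setT `&` N))); first by rewrite -betaE.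
  apply: lte_add_pinfty; rewrite -ge0_fin_numE //; apply: fin_num_measure => //.
  by rewrite setTI.
have bAE A : beta A = gamma A + alpha (A `&` N) := etrans (bE A) (betaE A).
exists beta; split=> [rg ra A mA e e0|f f0 mf].
  have e20 : (0 < e / 2)%R by rewrite divr_gt0.
  have [K1 [cK1 K1A K1e]] := rg A mA _ e20.
  have [K2 [cK2 K2A K2e]] := ra A mA _ e20.
  exists (K1 `|` K2); split; [exact: compactU|by rewrite subUset|].
  have mK1 : measurable (A `\` K1 : set (borelType T)).
    by apply: measurableD => //; exact: compact_borel.
  have mK2 : measurable (A `\` K2 : set (borelType T)).
    by apply: measurableD => //; exact: compact_borel.
  have mK : measurable (A `\` (K1 `|` K2) : set (borelType T)).
    by rewrite setDUr; exact: measurableI.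
  apply: (@le_trans _ _ (gamma (A `\` K1) + alpha (A `\` K2))).
    apply: (@le_trans _ _ (gamma (A `\` (K1 `|` K2)) + alpha ((A `\` (K1 `|` K2)) `&` N))).
      by rewrite -bAE; exact: lexx.
    apply: leeD; apply: le_measure; rewrite ?inE //.
    - by rewrite setDUr; exact: subIsetl.
    - exact: measurableI.
    - by rewrite setDUr => y [[_]].
  by rewrite [e]splitr EFinD; apply: leeD.
rewrite (_ : \int[beta]_y f y = \int[measure_add gamma alphaN]_y f y); last first.
  by apply: eq_measure_integral => A mA _; exact: bE.
by rewrite ge0_integral_measure_add // ge0_integral_mrestr.
Qed.

End measure_sum.

Lemma cone_over_closed (R : realType) (X : ptopologicalType) (B : set X) :
  closed B -> closed (@cone_over R X B).
Proof.
move=> cB; rewrite -[X in closed X]setCK; apply: open_closedC.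
rewrite (_ : ~` _ = [set y | (0 < (cone_radius y)%:num)%R /\ (~` B) (cone_base y)]).
  by apply: base_open; exact: closed_openC.
apply/seteqP; split=> y /=.
  move=> h; split; first by apply: cone_rad_gt0 => r0; apply: h; left.
  by move=> By; apply: h; right.
by move=> [y0 nB] [r0|//]; rewrite r0 ltxx in y0.
Qed.

Lemma cone_termE (R : realType) (X : ptopologicalType) (phi : X -> R) x (r : {nonneg R}) :
  (phi (cone_base (cone_pt x r)) * (cone_radius (cone_pt x r))%:num = phi x * r%:num)%R.
Proof.
rewrite cone_radiusE; have [->|r0] := eqVneq r 0%:nng%R; first by rewrite /= !mulr0.
by rewrite cone_baseE.
Qed.

Lemma cone_over_rescale (R : realType) (X : ptopologicalType) (B : set X)
    (y : cone R X) (a : R) (r : {nonneg R}) : cone_over B y ->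
  r%:num = (a * (cone_radius y)%:num)%R -> cone_over B (cone_pt (cone_base y) r).
Proof.
rewrite /cone_over /= cone_radiusE => By ry.
have [r0|r0] := eqVneq (r%:num) 0%R; [by left|right].
rewrite cone_baseE -?num_eq //; case: By => // y0.
by move: r0; rewrite ry y0 mulr0 eqxx.
Qed.

Section optimal_potentials.
Variables (R : realType) (X1 X2 : ptopologicalType).
Hypotheses (hX1 : hausdorff_space X1) (hX2 : hausdorff_space X2).
Variable H : cone R X1 * cone R X2 -> \bar R.
Hypothesis H_ge0 : forall y, 0 <= H y.
Hypothesis H_hom : radially_homogeneous H.
Hypothesis H_lsc : lower_semicontinuous H.

Lemma potential_le_extend B1 B2 phi1 phi2 :
  (forall y, cone_simplex B1 B2 y -> (potential phi1 phi2 y)%:E <= H y) ->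
  forall y, cone_product B1 B2 y -> (potential phi1 phi2 y)%:E <= H y.
Proof.
move=> hS [y1 y2] [/= By1 By2].
have [s0|s0] := eqVneq (rad y1 + rad y2)%R 0%R.
  move: s0 => /eqP; rewrite paddr_eq0 // => /andP[/eqP r1 /eqP r2].
  rewrite /potential /= r1 r2 !mulr0 addr0; exact: H_ge0.
have s_gt0 : (0 < rad y1 + rad y2)%R by rewrite lt_neqAle eq_sym s0 /= addr_ge0.
pose s : {posnum R} := PosNum s_gt0.
have r_ge0 (y : R) : (0 <= y -> 0 <= s%:num^-1 * y)%R by move=> ?; rewrite mulr_ge0.
have rad1 : (0 <= rad y1)%R by []. have rad2 : (0 <= rad y2)%R by [].
pose r1 := NngNum (r_ge0 _ rad1). pose r2 := NngNum (r_ge0 _ rad2).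
have E1 : y1 = cone_pt (cone_base y1) (s%:num * r1%:num)%:nng%R.
  rewrite -[LHS]cone_ptK; congr cone_pt; apply/val_inj => /=.
  by rewrite mulrA mulfV ?mul1r.
have E2 : y2 = cone_pt (cone_base y2) (s%:num * r2%:num)%:nng%R.
  rewrite -[LHS]cone_ptK; congr cone_pt; apply/val_inj => /=.
  by rewrite mulrA mulfV ?mul1r.
rewrite [in leRHS]E1 [in leRHS]E2 H_hom [in leLHS]E1 [in leLHS]E2.
rewrite /potential /= !cone_termE.
have := hS (cone_pt (cone_base y1) r1, cone_pt (cone_base y2) r2).
rewrite /potential /= !cone_termE => h.
apply: le_trans (_ : _ <= s%:num%:E * (phi1 (cone_base y1) * r1%:num + phi2 (cone_base
  y2) * r2%:num)%:E) _.
  by rewrite -EFinM lee_fin /= le_eqVlt; apply/orP; left; apply/eqP; ring.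
apply: (@lee_wpmul2l _ (rad y1 + rad y2)%:E); first by rewrite lee_fin.
apply: h; split; last first.
  by rewrite /= !cone_radiusE /= -mulrDr mulVf.
by split; apply: (@cone_over_rescale _ _ _ _ (s%:num^-1)%R).
Qed.

Variables (mu1 : {finite_measure set borelType X1 -> \bar R}).
Variables (mu2 : {finite_measure set borelType X2 -> \bar R}).
Hypotheses (mu1_radon : radon mu1) (mu2_radon : radon mu2).
Variable alpha : {finite_measure set borelType (cone R X1 * cone R X2)%type -> \bar R}.
Hypothesis alpha_plan : homogeneous_plan mu1 mu2 alpha.
Hypothesis alpha_optimal : \int[alpha]_y H y = transport_cost H mu1 mu2.
Hypothesis alpha_finite : \int[alpha]_y H y < +oo.
Variables (B1 : set X1) (B2 : set X2).
Hypotheses (cB1 : compact B1) (cB2 : compact B2).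
Let Y : ptopologicalType := (cone R X1 * cone R X2)%type.
Let W : set Y := cone_product B1 B2.

Lemma cone_product_closed : closed W.
Proof.
have -> : W = (fst @^-1` cone_over B1) `&` (snd @^-1` cone_over B2).
  by apply/seteqP; split=> y.
apply: closedI; apply: closed_comp => [y _|].
- exact: fst_continuous.
- by apply: cone_over_closed; exact: compact_closed.
- exact: snd_continuous.
- by apply: cone_over_closed; exact: compact_closed.
Qed.

(** Otherwise [cone_duality] would replace the part of [alpha] over [W] by a plan
    with the same marginals whose cost is lower by at least [e]. *)
Lemma optimal_potentials (e : R) : (0 < e)%R -> exists phi1 phi2, [/\
  alpha.-integrable W (EFin \o (fun y => phi1 (cone_base y.1) * rad y.1)%R),
  alpha.-integrable W (EFin \o (fun y => phi2 (cone_base y.2) * rad y.2)%R),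
  forall y, W y -> (potential phi1 phi2 y)%:E <= H y &
  \int[alpha]_(y in W) H y <= (\int[alpha]_(y in W) potential phi1 phi2 y)%R%:E + e%:E].
Proof.
move=> e0; apply: contrapT => nphi.
have mW : measurable (W : set (borelType Y)) by apply: closed_borel;
  exact: cone_product_closed.
have mWC : measurable (~` W : set (borelType Y)) by exact: measurableC.
have mH : measurable_fun [set: borelType Y] H by exact: lsc_borel.
have [ra fa m1E m2E] := alpha_plan.
have mtot : measurable_fun [set: borelType Y] (fun y : Y => (rad y.1 + rad y.2)%:E).
  apply: lsc_borel; apply: continuous_lsc => y.
  by apply: cvgD; [exact: rad1_continuous|exact: rad2_continuous].
have splitH := ge0_integral_setTD alpha mW H_ge0 mH.
have HWfin : \int[alpha]_(y in W) H y \is a fin_num.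
  rewrite ge0_fin_numE; last exact: integral_ge0.
  by apply: le_lt_trans alpha_finite; rewrite splitH leeDl // integral_ge0.
pose D := (fine (\int[alpha]_(y in W) H y) - e)%R.
have regW (X : ptopologicalType) (mu : {finite_measure set borelType X -> \bar R})
    (p : Y -> cone R X) : continuous p -> radon mu -> hausdorff_space X ->
    (forall A, measurable (A : set (borelType X)) -> mu A =
      \int[alpha]_y (marginal_density p A y)%:E) ->
    inner_regular_marginal alpha W p.
  move=> cp rmu hX muE A mA d d0; have [K [cK KA Kd]] := rmu A mA d d0.
  exists K; split=> //; apply: (@le_trans _ _ (mu (A `\` K))); last exact: Kd.
  have mAK : measurable (A `\` K : set (borelType X)).
    by apply: measurableD => //; exact: compact_borel.
  rewrite muE // (@ge0_integral_setTD _ _ _ alpha W) //.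
  - by rewrite leeDl // integral_marginal_density_ge0.
  - by move=> y; rewrite lee_fin marginal_density_ge0.
  - exact: marginal_density_measurable.
have m1E' A : measurable (A : set (borelType X1)) -> mu1 A =
  \int[alpha]_y (marginal_density fst A y)%:E.
  by move=> mA; rewrite m1E // -marginal_densityE.
have m2E' A : measurable (A : set (borelType X2)) -> mu2 A =
  \int[alpha]_y (marginal_density snd A y)%:E.
  by move=> mA; rewrite m2E // -marginal_densityE.
have [||gamma [rg fg g1 g2 gH]] :=
  @cone_duality R X1 X2 hX1 hX2 H H_ge0 H_lsc alpha W mW _ B1 B2 cB1 cB2
  (regW _ _ _ (@fst_continuous R X1 X2) mu1_radon hX1 m1E') (regW _ _ _
    (@snd_continuous R X1 X2) mu2_radon hX2 m2E') D.
- apply: le_lt_trans fa; rewrite (@ge0_integral_setTD _ _ _ alpha W) //.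
  by rewrite leeDl // integral_ge0 // => y _; rewrite lee_fin addr_ge0.
- move=> phi1 phi2 [i1 i2 hS]; rewrite leNgt; apply/negP => Dphi; apply: nphi.
  exists phi1, phi2; split=> //; first exact: potential_le_extend.
  rewrite -(fineK HWfin) -EFinD lee_fin -lerBlDr; exact: ltW.
have [beta [rb intb]] := @measure_paste R Y gamma alpha (~` W) (cone_pair_hausdorff hX1
  hX2) mWC.
have beta_plan : homogeneous_plan mu1 mu2 beta.
  split.
  - exact: rb.
  - rewrite intb //; apply: lte_add_pinfty => //.
    apply: le_lt_trans fa; rewrite (@ge0_integral_setTD _ _ _ alpha W _ mW _ mtot) //.
    by rewrite leeDr // integral_ge0 // => y _; rewrite lee_fin addr_ge0.
  - move=> A mA; rewrite m1E' // marginal_densityE intb.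
    + rewrite g1 // -ge0_integral_setTD //.
      * by move=> y; rewrite lee_fin marginal_density_ge0.
      * exact: (marginal_density_measurable (@fst_continuous R X1 X2)).
    + by move=> y; rewrite lee_fin marginal_density_ge0.
    + exact: (marginal_density_measurable (@fst_continuous R X1 X2)).
  - move=> A mA; rewrite m2E' // marginal_densityE intb.
    + rewrite g2 // -ge0_integral_setTD //.
      * by move=> y; rewrite lee_fin marginal_density_ge0.
      * exact: (marginal_density_measurable (@snd_continuous R X1 X2)).
    + by move=> y; rewrite lee_fin marginal_density_ge0.
    + exact: (marginal_density_measurable (@snd_continuous R X1 X2)).
have : transport_cost H mu1 mu2 <= \int[beta]_y H y.
  by apply: ereal_inf_lbound; exists beta.
rewrite -alpha_optimal intb // splitH.
have HCfin : \int[alpha]_(y in ~` W) H y \is a fin_num.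
  rewrite ge0_fin_numE; last exact: integral_ge0.
  by apply: le_lt_trans alpha_finite; rewrite splitH leeDr // integral_ge0.
rewrite leeD2rE // => /le_trans /(_ gH).
by rewrite -(fineK HWfin) lee_fin /D; lra.
Qed.

End optimal_potentials.

(** * Calibrated sets *)

Lemma cone_over_pt (R : realType) (X : ptopologicalType) (B : set X) x (r : {nonneg R}) :
  cone_over B (cone_pt x r) <-> (r%:num = 0)%R \/ B x.
Proof.
rewrite /cone_over /= cone_radiusE; have [r0|r0] := eqVneq (r%:num) 0%R.
  by split=> _; left.
by rewrite cone_baseE // -num_eq.
Qed.

Section calibration.
Variables (R : realType) (X1 X2 : ptopologicalType).
Let Y : ptopologicalType := (cone R X1 * cone R X2)%type.
Variable H : Y -> \bar R.
Hypothesis H_ge0 : forall y, 0 <= H y.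
Hypothesis H_hom : radially_homogeneous H.
Hypothesis H_convex : radially_convex H.

Lemma cost_scale x1 x2 (r1 r2 t1 t2 : {nonneg R}) (l : R) : (0 < l)%R ->
  (t1%:num = l * r1%:num)%R -> (t2%:num = l * r2%:num)%R ->
  H (cone_pt x1 t1, cone_pt x2 t2) = l%:E * H (cone_pt x1 r1, cone_pt x2 r2).
Proof.
move=> l0 h1 h2; rewrite -(H_hom x1 x2 r1 r2 (PosNum l0)).
by congr (H (cone_pt _ _, cone_pt _ _)); apply/val_inj.
Qed.

Lemma cost_subadditive x1 x2 (r1 r2 s1 s2 t1 t2 : {nonneg R}) :
  (t1%:num = r1%:num + s1%:num)%R -> (t2%:num = r2%:num + s2%:num)%R ->
  H (cone_pt x1 t1, cone_pt x2 t2) <=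
  H (cone_pt x1 r1, cone_pt x2 r2) + H (cone_pt x1 s1, cone_pt x2 s2).
Proof.
move=> h1 h2; have half_ge0 : (0 <= 2^-1 :> R)%R by rewrite invr_ge0.
pose h := NngNum half_ge0.
have hh : (h%:num + h%:num = 1)%R by rewrite /=; field.
have := H_convex x1 x2 r1 r2 s1 s2 hh.
set u1 := (X in H (cone_pt x1 X, _) <= _); set u2 := (X in H (_, cone_pt x2 X) <= _).
have e1 : (t1%:num = 2 * u1%:num)%R by rewrite h1 /=; field.
have e2 : (t2%:num = 2 * u2%:num)%R by rewrite h2 /=; field.
rewrite (@cost_scale _ _ u1 u2 t1 t2 2%R) // => hc.
apply: (@le_trans _ _ (2%:E * ((2^-1)%:E * H (cone_pt x1 r1, cone_pt x2 r2) +
  (2^-1)%:E * H (cone_pt x1 s1, cone_pt x2 s2)))); first by apply: lee_wpmul2l.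
rewrite ge0_muleDr; try by apply: mule_ge0.
by rewrite !muleA -!EFinM mulfV // !mul1e.
Qed.

Variables (B1 : set X1) (B2 : set X2).
Variables (phi1 : nat -> X1 -> R) (phi2 : nat -> X2 -> R).
Hypothesis phi_le : forall n y, cone_product B1 B2 y ->
  (potential (phi1 n) (phi2 n) y)%:E <= H y.

Let gap n (y : Y) : R := (fine (H y) - potential (phi1 n) (phi2 n) y)%R.

(** Requiring the defects of the potentials to be summable, instead of vanishing
    in the limit, gives stability under sums directly and follows almost
    everywhere from integral bounds. *)
Definition calibrated : set Y := [set y | [/\ cone_product B1 B2 y, H y < +oo &
  exists C : R, forall N, (\sum_(0 <= n < N)
    (fine (H y) - potential (phi1 n) (phi2 n) y) <= C)%R]].

Let cost_fin y : H y < +oo -> H y \is a fin_num.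
Proof. by move=> ?; rewrite ge0_fin_numE. Qed.

Lemma potential_pt n x1 x2 (r1 r2 : {nonneg R}) :
  potential (phi1 n) (phi2 n) (cone_pt x1 r1, cone_pt x2 r2) =
  (phi1 n x1 * r1%:num + phi2 n x2 * r2%:num)%R.
Proof. by rewrite /potential !cone_termE. Qed.

Lemma calibrated_scale x1 x2 (r1 r2 t1 t2 : {nonneg R}) (l : R) : (0 < l)%R ->
  (t1%:num = l * r1%:num)%R -> (t2%:num = l * r2%:num)%R ->
  calibrated (cone_pt x1 r1, cone_pt x2 r2) ->
  calibrated (cone_pt x1 t1, cone_pt x2 t2).
Proof.
move=> l0 h1 h2 [[/= /cone_over_pt w1 /cone_over_pt w2] Hr [C hC]].
have E := cost_scale x1 x2 l0 h1 h2; have fr := cost_fin Hr.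
split.
- split; apply/cone_over_pt => /=; rewrite ?h1 ?h2.
    by case: w1 => [->|]; [left; rewrite mulr0|right].
  by case: w2 => [->|]; [left; rewrite mulr0|right].
- by rewrite E -(fineK fr) -EFinM ltry.
- exists (l * C)%R => N; rewrite (_ : (\sum_(0 <= n < N) _)%R =
    (l * \sum_(0 <= n < N) gap n (cone_pt x1 r1, cone_pt x2 r2))%R).
    by apply: ler_wpM2l; [exact: ltW|exact: hC].
  rewrite mulr_sumr; apply: eq_bigr => n _.
  rewrite /gap !potential_pt E -(fineK fr) -EFinM /= h1 h2; ring.
Qed.

Lemma calibrated_add x1 x2 (r1 r2 s1 s2 t1 t2 : {nonneg R}) :
  (t1%:num = r1%:num + s1%:num)%R -> (t2%:num = r2%:num + s2%:num)%R ->
  calibrated (cone_pt x1 r1, cone_pt x2 r2) ->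
  calibrated (cone_pt x1 s1, cone_pt x2 s2) ->
  calibrated (cone_pt x1 t1, cone_pt x2 t2).
Proof.
move=> h1 h2 [[/= /cone_over_pt w1 /cone_over_pt w2] Hr [C hC]].
move=> [[/= /cone_over_pt v1 /cone_over_pt v2] Hs [C' hC']].
have E := cost_subadditive x1 x2 h1 h2.
have Ht : H (cone_pt x1 t1, cone_pt x2 t2) < +oo.
  by apply: (le_lt_trans E); apply: lte_add_pinfty.
have fr := cost_fin Hr; have fs := cost_fin Hs; have ft := cost_fin Ht.
split=> //.
- split; apply/cone_over_pt => /=; rewrite ?h1 ?h2.
    by case: w1 => [->|]; [case: v1 => [->|]; [left; rewrite addr0|right]|right].
  by case: w2 => [->|]; [case: v2 => [->|]; [left; rewrite addr0|right]|right].
- exists (C + C')%R => N; apply: le_trans (lerD (hC N) (hC' N)).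
  rewrite -big_split /=; apply: ler_sum => n _.
  rewrite !potential_pt h1 h2.
  move: E; rewrite -(fineK fr) -(fineK fs) -(fineK ft) -EFinD lee_fin /=; lra.
Qed.

(** The total of the potentials over the pairs does not see the permutation, and
    some potential has a total defect below [e], as the defects are summable. *)
Lemma calibrated_monotone (N : nat) (y : 'I_N -> Y) (s : 'S_N) :
  (forall i, calibrated (y i)) ->
  \sum_(i < N) H (y i) <= \sum_(i < N) H ((y i).1, (y (s i)).2).
Proof.
move=> cy; pose z i : Y := ((y i).1, (y (s i)).2).
have Wz i : cone_product B1 B2 (z i).
  by have [[h1 _] _ _] := cy i; have [[_ h2] _ _] := cy (s i).
have fy i : H (y i) \is a fin_num by have [_ h _] := cy i; exact: cost_fin.
have pE n : (\sum_(i < N) potential (phi1 n) (phi2 n) (y i) =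
    \sum_(i < N) potential (phi1 n) (phi2 n) (z i))%R.
  rewrite /potential !big_split /=; congr (_ + _)%R.
  exact: (reindex_inj (@perm_inj _ s)).
have [C hC] := @choice _ _ (fun i c => forall M, (\sum_(0 <= n < M) gap n (y i) <= c)%R)
  (fun i => let: And3 _ _ h := cy i in h).
apply/lee_addgt0Pr => e e0.
have [n gn] : exists n, (\sum_(i < N) gap n (y i) <= e)%R.
  apply: contrapT => /forallNP hn.
  have hM M : (M%:R * e <= \sum_(i < N) C i)%R.
    apply: (@le_trans _ _ (\sum_(i < N) \sum_(0 <= n < M) gap n (y i))%R); last first.
      by apply: ler_sum => i _; exact: hC.
    rewrite exchange_big /= mulr_natl -[X in (_ *+ X)%R](subn0 M) -sumr_const_nat.
    by apply: ler_sum => n _; have /negP := hn n; rewrite -ltNge => /ltW.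
  have := hM (Num.truncn ((\sum_(i < N) C i) / e)).+1.
  by rewrite -ler_pdivlMr // leNgt truncnS_gt.
have -> : \sum_(i < N) H (y i) = (\sum_(i < N) fine (H (y i)))%R%:E.
  by rewrite -sumEFin; apply: eq_bigr => i _; rewrite fineK.
have h1 : (\sum_(i < N) fine (H (y i)) <= \sum_(i < N) potential (phi1 n) (phi2 n) (z
  i) + e)%R.
  by move: gn; rewrite /gap sumrB pE; lra.
apply: (@le_trans _ _ ((\sum_(i < N) potential (phi1 n) (phi2 n) (z i))%R%:E + e%:E)).
  by rewrite -EFinD lee_fin.
by rewrite leeD2r // -sumEFin; apply: lee_sum => i _; exact: phi_le.
Qed.

End calibration.

Section calibrated_ae.
Variables (R : realType) (X1 X2 : ptopologicalType).
Let Y : ptopologicalType := (cone R X1 * cone R X2)%type.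
Variable H : Y -> \bar R.
Hypothesis H_ge0 : forall y, 0 <= H y.
Hypothesis H_lsc : lower_semicontinuous H.
Variables (alpha : {measure set borelType Y -> \bar R}).
Variables (B1 : set X1) (B2 : set X2).
Let W : set Y := cone_product B1 B2.
Hypothesis mW : measurable (W : set (borelType Y)).
Hypothesis H_fin : \int[alpha]_(y in W) H y < +oo.
Variables (phi1 : nat -> X1 -> R) (phi2 : nat -> X2 -> R).
Hypothesis phi_int : forall n, alpha.-integrable W (EFin \o potential (phi1 n) (phi2 n)).
Hypothesis phi_le : forall n y, W y -> (potential (phi1 n) (phi2 n) y)%:E <= H y.
Hypothesis phi_approx : forall n, \int[alpha]_(y in W) H y <=
  (\int[alpha]_(y in W) potential (phi1 n) (phi2 n) y)%R%:E + (2^-1 ^+ n.+1)%:E.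

(** The sum of the defects is integrable, hence finite almost everywhere. *)
Lemma calibrated_negligible : alpha.-negligible (W `\` calibrated H B1 B2 phi1 phi2).
Proof.
pose f n y := H y - (potential (phi1 n) (phi2 n) y)%:E.
have mH : measurable_fun (W : set (borelType Y)) H by apply: measurable_funTS;
  exact: lsc_borel.
have iH : alpha.-integrable W H.
  apply/integrableP; split=> //; apply: le_lt_trans H_fin.
  rewrite le_eqVlt; apply/orP; left; apply/eqP; apply: eq_integral => y _.
  by rewrite gee0_abs.
have mf n : measurable_fun (W : set (borelType Y)) (f n).
  by apply: emeasurable_funB => //; exact: measurable_int (phi_int n).
have f0 n y : W y -> 0 <= f n y by move=> Wy; rewrite sube_ge0 ?phi_le // orbT.
have If n : \int[alpha]_(y in W) f n y <= (2^-1 ^+ n.+1)%:E.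
  rewrite /f integralB //; last exact: phi_int.
  have pfin := integrable_fin_num mW (phi_int n).
  rewrite leeBlDr //; apply: le_trans (phi_approx n) _.
  by rewrite /Rintegral fineK // addeC.
have mS : measurable_fun (W : set (borelType Y)) (fun y => \sum_(0 <= n <oo) f n y).
  by apply: ge0_emeasurable_sum => [k y Wy _|k _]; [exact: f0|exact: mf].
have S0 y : W y -> 0 <= \sum_(0 <= n <oo) f n y.
  by move=> Wy; apply: nneseries_ge0 => n _ _; exact: f0.
have iS : alpha.-integrable W (fun y => \sum_(0 <= n <oo) f n y).
  apply/integrableP; split=> //.
  rewrite (_ : \int[alpha]_(y in W) _ = \int[alpha]_(y in W) \sum_(0 <= n <oo) f n y);
    last first.
    by apply: eq_integral => y; rewrite inE => Wy; rewrite gee0_abs // S0.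
  rewrite integral_nneseries //.
  apply: (@le_lt_trans _ _ (\sum_(0 <= n <oo) (1 / (2 ^ n.+1)%:R)%:E)); last first.
    by apply: le_lt_trans (epsilon_trick0 _ _) _ => //; exact: ltry.
  apply: lee_nneseries => n.
    by move=> _ _; apply: integral_ge0; exact: f0.
  move=> _; apply: le_trans (If n) _; by rewrite lee_fin natrX div1r exprVn.
have := integrable_ae mW iS; have := integrable_ae mW iH.
move=> nH nS; apply: negligibleS (negligibleU nH nS) => y [Wy ncal].
apply: contrapT => /not_orP[/contrapT Hy /contrapT Sy]; apply: ncal.
have {}Hy := Hy Wy; have {}Sy := Sy Wy.
split=> //; first by rewrite -ge0_fin_numE.
exists (fine (\sum_(0 <= n <oo) f n y)) => N.
rewrite -lee_fin fineK // -sumEFin.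
rewrite (eq_bigr (fun n => f n y)); last first.
  by move=> n _; rewrite /f EFinB fineK.
by apply: nneseries_lim_ge => n *; exact: f0.
Qed.

End calibrated_ae.

(** * Convex cone hulls that stay sigma-compact *)

Local Close Scope ereal_scope.

Section linear_combination.
Variables (R : realType) (X : ptopologicalType).
Implicit Types (l : R) (x : X) (r : {nonneg R}) (y z w : cone R X).

Definition same_ray y z := [\/ rad y = 0, rad z = 0 | cone_base y = cone_base z].

(** [w = l y + z] on a common ray, without naming a base point: every two of the
    three points that differ from the vertex have the same base point. *)
Definition cone_lincomb l y z w :=
  [/\ rad w = l * rad y + rad z, same_ray y z, same_ray y w & same_ray z w].

Lemma cone_pt_of x y : rad y = 0 \/ cone_base y = x -> y = cone_pt x (cone_radius y).
Proof.
case=> [y0|<-]; last by rewrite cone_ptK.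
rewrite {1}(cone_rad0 x y0); congr cone_pt; exact/val_inj.
Qed.

Lemma same_ray_pt x r r' : same_ray (cone_pt x r) (cone_pt x r').
Proof.
rewrite /same_ray !cone_radiusE.
have [r0|r0] := eqVneq (r%:num) 0; first exact: Or31.
have [r'0|r'0] := eqVneq (r'%:num) 0; first exact: Or32.
by apply: Or33; rewrite !cone_baseE // -num_eq.
Qed.

Lemma cone_lincomb_pt l x r s t : t%:num = l * r%:num + s%:num ->
  cone_lincomb l (cone_pt x r) (cone_pt x s) (cone_pt x t).
Proof. by move=> h; split; rewrite ?cone_radiusE //; exact: same_ray_pt. Qed.

(** A positive [l] excludes cancellation: if [l y + z] is the vertex, then so are
    [y] and [z], and they can be given the base point [x]. *)
Lemma cone_lincomb_at l x y z t : 0 < l -> cone_lincomb l y z (cone_pt x t) ->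
  exists r s, [/\ y = cone_pt x r, z = cone_pt x s & t%:num = l * r%:num + s%:num].
Proof.
move=> l0 [+ yz yw zw]; rewrite cone_radiusE => ht.
exists (cone_radius y), (cone_radius z); split=> //; apply: cone_pt_of.
  have [t0|t0] := eqVneq (t%:num) 0.
    left; have : l * rad y <= 0 by rewrite -t0 ht lerDl.
    by rewrite pmulr_rle0 // => h; apply/eqP; rewrite eq_le h /=.
  move: yw; rewrite /same_ray cone_radiusE cone_baseE -?num_eq //.
  by case=> [?|/eqP|?]; [left|rewrite (negbTE t0)|right].
have [t0|t0] := eqVneq (t%:num) 0.
  left; have h : rad z <= 0 by rewrite -t0 ht lerDr mulr_ge0 // ltW.
  by apply/eqP; rewrite eq_le h /=.
move: zw; rewrite /same_ray cone_radiusE cone_baseE -?num_eq //.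
by case=> [?|/eqP|?]; [left|rewrite (negbTE t0)|right].
Qed.

Hypothesis hX : hausdorff_space X.

Lemma cone_lincomb_closed (T : topologicalType) (l : T -> R) (y z w : T -> cone R X) :
  continuous l -> continuous y -> continuous z -> continuous w ->
  closed [set t | cone_lincomb (l t) (y t) (z t) (w t)].
Proof.
move=> cl cy cz cw.
have rc (u : T -> cone R X) : continuous u -> continuous (fun t => rad (u t)).
  move=> cu t; apply: (@continuous_comp _ _ _ u (fun v : cone R X => rad v)).
    exact: cu.
  exact: cone_radius_continuous.
have sc (u v : T -> cone R X) : continuous u -> continuous v ->
    closed [set t | same_ray (u t) (v t)].
  move=> cu cv; apply: (@closed_comp _ _ (fun t => (u t, v t))
    [set p | same_ray p.1 p.2]); last exact: same_base_closed.
  by move=> t _; exact: (cvg_pair (cu t) (cv t)).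
have -> : [set t | cone_lincomb (l t) (y t) (z t) (w t)] =
  ([set t | rad (w t) - (l t * rad (y t) + rad (z t)) = 0] `&`
   ([set t | same_ray (y t) (z t)] `&` ([set t | same_ray (y t) (w t)] `&`
   [set t | same_ray (z t) (w t)]))).
  apply/seteqP; split=> t /=.
    by move=> [h1 h2 h3 h4]; do !split=> //; rewrite h1 subrr.
  by move=> [/eqP]; rewrite subr_eq0 => /eqP h1 [h2 [h3 h4]]; split.
apply: closedI; last by apply: closedI; [exact: sc|apply: closedI; exact: sc].
  apply: (@closed_comp _ _ (fun t => rad (w t) - (l t * rad (y t) + rad (z t))) [set 0]).
    move=> t _; apply: cvgB; first exact: rc.
    apply: cvgD; last exact: rc.
    by apply: cvgM; [exact: cl|exact: rc].
exact: closed_eq.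
Qed.

End linear_combination.

Section hull.
Variables (R : realType) (X1 X2 : ptopologicalType).
Let Y : ptopologicalType := (cone R X1 * cone R X2)%type.
Hypotheses (hX1 : hausdorff_space X1) (hX2 : hausdorff_space X2).

(** Compact sets whose base points are known to stay in compact sets; sums of
    their elements then stay in a compact set too. *)
Definition bounded_compact (K : set Y) := compact K /\
  exists B1 B2 (M : R), [/\ compact B1, compact B2 &
    K `<=` cone_product B1 B2 `&` [set y | rad y.1 <= M /\ rad y.2 <= M]].

Definition radial_sum (L : set R) (G0 G : set Y) : set Y :=
  [set w | exists l y z, [/\ L l, G0 y, G z, cone_lincomb l y.1 z.1 w.1 &
    cone_lincomb l y.2 z.2 w.2]].

Let base_sum (X : ptopologicalType) (B B' : set X) l (y z w : cone R X) :
  cone_over B y -> cone_over B' z -> cone_lincomb l y z w -> cone_over (B `|` B') w.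
Proof.
rewrite /cone_over /= => -[y0|By] [z0|Bz] [h1 h2 h3 h4].
- by left; rewrite h1 y0 z0 mulr0 addr0.
- by case: h4 => [z0|w0|<-]; [left; rewrite h1 y0 z0 mulr0 addr0|left|right; right].
- by case: h3 => [y0|w0|<-]; [left; rewrite h1 y0 z0 mulr0 addr0|left|right; left].
- case: h3 => [y0|w0|<-]; [|by left|by right; left].
  by case: h4 => [z0|w0|<-]; [left; rewrite h1 y0 z0 mulr0 addr0|left|right; right].
Qed.

(** It is the projection of a closed subset of a compact product, cut out by the
    closed relation [w = l y + z]. *)
Lemma radial_sum_compact (a b : R) K K' : 0 < a -> bounded_compact K ->
  bounded_compact K' -> bounded_compact (radial_sum `[a, b] K K').
Proof.
move=> a0 [cK [B1 [B2 [M [cB1 cB2 KB]]]]] [cK' [B1' [B2' [M' [cB1' cB2' KB']]]]].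
have hY := cone_pair_hausdorff hX1 hX2.
pose N := `|b| * `|M| + `|M'|.
pose V := cone_product (B1 `|` B1') (B2 `|` B2') `&` [set y :
  Y | rad y.1 <= N /\ rad y.2 <= N].
have cV : compact V by apply: cone_product_bounded_compact; exact: compactU.
have sub : radial_sum `[a, b] K K' `<=` V.
  move=> w [l [y [z [/= lab Ky Kz h1 h2]]]].
  have [[By1 By2] [My1 My2]] := KB y Ky; have [[Bz1 Bz2] [Mz1 Mz2]] := KB' z Kz.
  move: lab; rewrite in_itv /= => /andP[al lb].
  have l0 : 0 <= l by rewrite (le_trans (ltW a0)).
  split; split => /=.
  - exact: base_sum h1.
  - exact: base_sum h2.
  - case: h1 => -> _ _ _; apply: lerD; last exact: le_trans (ler_norm _).
    by apply: ler_pM => //; [exact: le_trans lb (ler_norm _)|exact: le_trans (ler_norm _)].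
  - case: h2 => -> _ _ _; apply: lerD; last exact: le_trans (ler_norm _).
    by apply: ler_pM => //; [exact: le_trans lb (ler_norm _)|exact: le_trans (ler_norm _)].
split; last first.
  exists (B1 `|` B1'), (B2 `|` B2'), N; split=> //; exact: compactU.
pose T : topologicalType := (R * (Y * (Y * Y)))%type.
pose C : set T := (`[a, b] `*` (K `*` (K' `*` V))) `&`
  ([set t | cone_lincomb t.1 t.2.1.1 t.2.2.1.1 t.2.2.2.1] `&`
   [set t | cone_lincomb t.1 t.2.1.2 t.2.2.1.2 t.2.2.2.2]).
have c1 (t : T) : continuous_at t (fun t : T => t.1) by exact: cvg_fst.
have c2 : continuous (fun t : T => t.2.1).
  by move=> t; apply: (@continuous_comp _ _ _ snd fst); [exact: cvg_snd|exact: cvg_fst].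
have c22 : continuous (fun t : T => t.2.2).
  by move=> t; apply: (@continuous_comp _ _ _ snd snd); [exact: cvg_snd|exact: cvg_snd].
have c3 : continuous (fun t : T => t.2.2.1).
  by move=> t; apply: (@continuous_comp _ _ _ (fun t : T => t.2.2) fst);
    [exact: c22|exact: cvg_fst].
have c4 : continuous (fun t : T => t.2.2.2).
  by move=> t; apply: (@continuous_comp _ _ _ (fun t : T => t.2.2) snd);
    [exact: c22|exact: cvg_snd].
have p1 (u : T -> Y) : continuous u -> continuous (fun t => (u t).1).
  by move=> cu t; apply: (@continuous_comp _ _ _ u fst); [exact: cu|exact: cvg_fst].
have p2 (u : T -> Y) : continuous u -> continuous (fun t => (u t).2).
  by move=> cu t; apply: (@continuous_comp _ _ _ u snd); [exact: cu|exact: cvg_snd].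
have cC : compact C.
  apply: compact_closedI.
    apply: compact_setX; first exact: segment_compact.
    by apply: compact_setX => //; exact: compact_setX.
  apply: closedI.
    exact: (@cone_lincomb_closed R X1 hX1 T (fun t =>
      t.1) _ _ _ c1 (p1 _ c2) (p1 _ c3) (p1 _ c4)).
  exact: (@cone_lincomb_closed R X2 hX2 T (fun t =>
    t.1) _ _ _ c1 (p2 _ c2) (p2 _ c3) (p2 _ c4)).
rewrite (_ : radial_sum _ _ _ = (fun t : T => t.2.2.2) @` C).
  by apply: continuous_compact => //; exact: continuous_subspaceT.
apply/seteqP; split=> w.
  move=> Sw; have Vw := sub w Sw; move: Sw => [l [y [z [lab Ky Kz h1 h2]]]].
  by exists (l, (y, (z, w))) => //; do !split.
move=> [[l [y [z w']]] [[/= lab [Ky [Kz Vw]]] [h1 h2]] <-].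
by exists l, y, z; split.
Qed.

Definition sigma_bounded_compact (G : set Y) := exists2 K : (set Y)^nat,
  (forall n, bounded_compact (K n)) & G = \bigcup_n K n.

Lemma bounded_compact0 : bounded_compact set0.
Proof. by split; [exact: compact0|exists set0, set0, 0; split=> //; exact: compact0]. Qed.

Lemma sigma_bounded_compact_bigcup (I : countType) (K : I -> set Y) :
  (forall i, bounded_compact (K i)) -> sigma_bounded_compact (\bigcup_i K i).
Proof.
move=> cK; exists (fun n => if unpickle n is Some i then K i else set0).
  by move=> n; case: unpickle => [i|]; [exact: cK|exact: bounded_compact0].
apply/seteqP; split=> y [i _ Ky].
  by exists (pickle i) => //; rewrite pickleK.
by move: Ky; case: unpickle => // j Ky; exists j.
Qed.

Lemma sigma_radial_sum G0 G : sigma_bounded_compact G0 -> sigma_bounded_compact G ->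
  sigma_bounded_compact (radial_sum [set l | 0 < l] G0 G).
Proof.
move=> [K cK ->] [K' cK' ->].
have := @sigma_bounded_compact_bigcup (nat * (nat * nat))%type
  (fun i => radial_sum `[i.1.+1%:R^-1, i.1.+1%:R] (K i.2.1) (K' i.2.2)).
rewrite (_ : \bigcup_i _ = radial_sum [set l | 0 < l] (\bigcup_n K n) (\bigcup_n K' n)).
  by apply=> i; apply: radial_sum_compact => //; rewrite invr_gt0.
apply/seteqP; split=> w.
  move=> [[N [i j]] _ [l [y [z [/= lab Ky Kz h1 h2]]]]].
  exists l, y, z; split=> //; [|by exists i|by exists j].
  by move: lab; rewrite in_itv /= => /andP[+ _]; apply: lt_le_trans; rewrite invr_gt0.
move=> [l [y [z [/= l0 [i _ Ky] [j _ Kz] h1 h2]]]].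
exists (maxn (Num.truncn l) (Num.truncn l^-1), (i, j)) => //.
exists l, y, z; split=> //=; rewrite in_itv /=; apply/andP; split.
  rewrite invf_ple ?posrE //; apply: le_trans (ltW (truncnS_gt _)) _.
  by rewrite ler_nat ltnS leq_maxr.
by apply: le_trans (ltW (truncnS_gt _)) _; rewrite ler_nat ltnS leq_maxl.
Qed.

Definition vertex_pair : Y := (cone_pt point 0%:nng, cone_pt point 0%:nng).

Definition radial_hull (G0 : set Y) (n : nat) : set Y :=
  iter n (radial_sum [set l | 0 < l] G0) [set vertex_pair].

Lemma sigma_radial_hull G0 n : sigma_bounded_compact G0 ->
  sigma_bounded_compact (radial_hull G0 n).
Proof.
move=> cG0; elim: n => [|n IHn]; last exact: sigma_radial_sum.
exists (fun=> [set vertex_pair]).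
  move=> _; split; first exact: compact_set1.
  exists set0, set0, 0; split; [exact: compact0|exact: compact0|].
  move=> _ ->; split; first by split; left; rewrite cone_radiusE.
  by split; rewrite /= cone_radiusE.
by apply/seteqP; split=> y; [exists 0%N|case].
Qed.

Let pair_pt (x1 : X1) (x2 : X2) r1 r2 : Y := (cone_pt x1 r1, cone_pt x2 r2).

Lemma pair_ptK (y : Y) : y =
  pair_pt (cone_base y.1) (cone_base y.2) (cone_radius y.1) (cone_radius y.2).
Proof. by case: y => y1 y2; rewrite /pair_pt !cone_ptK. Qed.

Lemma radial_hull_step G0 n x1 x2 (t1 t2 : {nonneg R}) :
  radial_hull G0 n.+1 (pair_pt x1 x2 t1 t2) -> exists l r1 r2 s1 s2, [/\ 0 < l,
    G0 (pair_pt x1 x2 r1 r2), radial_hull G0 n (pair_pt x1 x2 s1 s2),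
    t1%:num = l * r1%:num + s1%:num & t2%:num = l * r2%:num + s2%:num].
Proof.
move=> [l [[y1 y2] [[z1 z2] [/= l0 Gy Gz h1 h2]]]].
have [r1 [s1 [ey1 ez1 e1]]] := cone_lincomb_at l0 h1.
have [r2 [s2 [ey2 ez2 e2]]] := cone_lincomb_at l0 h2.
by exists l, r1, r2, s1, s2; split=> //; rewrite /pair_pt -?ey1 -?ey2 -?ez1 -?ez2.
Qed.

Lemma radial_hull_stepr G0 n x1 x2 l (r1 r2 s1 s2 t1 t2 : {nonneg R}) : 0 < l ->
  t1%:num = l * r1%:num + s1%:num -> t2%:num = l * r2%:num + s2%:num ->
  G0 (pair_pt x1 x2 r1 r2) -> radial_hull G0 n (pair_pt x1 x2 s1 s2) ->
  radial_hull G0 n.+1 (pair_pt x1 x2 t1 t2).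
Proof.
move=> l0 e1 e2 Gr Gs; exists l, (pair_pt x1 x2 r1 r2), (pair_pt x1 x2 s1 s2).
by split=> //=; exact: cone_lincomb_pt.
Qed.

Lemma radial_hull0E G0 x1 x2 (t1 t2 : {nonneg R}) :
  radial_hull G0 0 (pair_pt x1 x2 t1 t2) -> t1%:num = 0 /\ t2%:num = 0.
Proof.
move=> /= [/(congr1 (@cone_radius _ _)) + /(congr1 (@cone_radius _ _))].
by rewrite !cone_radiusE => -> ->.
Qed.

Lemma radial_hull_scale G0 n x1 x2 (t1 t2 u1 u2 : {nonneg R}) k : 0 < k ->
  u1%:num = k * t1%:num -> u2%:num = k * t2%:num ->
  radial_hull G0 n (pair_pt x1 x2 t1 t2) -> radial_hull G0 n (pair_pt x1 x2 u1 u2).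
Proof.
move=> k0; elim: n t1 t2 u1 u2 => [|n IHn] t1 t2 u1 u2 e1 e2 h.
  have [t10 t20] := radial_hull0E h; move: h; congr (_ = _).
  by congr (cone_pt _ _, cone_pt _ _); apply/val_inj; rewrite /= ?e1 ?e2 ?t10 ?t20 mulr0.
have [l [r1 [r2 [s1 [s2 [l0 Gr Gs h1 h2]]]]]] := radial_hull_step h.
have s_ge0 (s : {nonneg R}) : 0 <= k * s%:num by rewrite mulr_ge0 // ltW.
apply: (@radial_hull_stepr _ _ _ _ (k * l) r1 r2 (NngNum (s_ge0 s1)) (NngNum (s_ge0
  s2))) => //.
- exact: mulr_gt0.
- by rewrite e1 h1 /=; ring.
- by rewrite e2 h2 /=; ring.
- by apply: (IHn s1 s2).
Qed.

Lemma radial_hull_add G0 n m x1 x2 (r1 r2 s1 s2 t1 t2 : {nonneg R}) :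
  t1%:num = r1%:num + s1%:num -> t2%:num = r2%:num + s2%:num ->
  radial_hull G0 n (pair_pt x1 x2 r1 r2) -> radial_hull G0 m (pair_pt x1 x2 s1 s2) ->
  radial_hull G0 (n + m) (pair_pt x1 x2 t1 t2).
Proof.
elim: n r1 r2 t1 t2 => [|n IHn] r1 r2 t1 t2 e1 e2 hr hs.
  have [r10 r20] := radial_hull0E hr.
  rewrite add0n (_ : t1 = s1); last by apply/val_inj; rewrite /= e1 r10 add0r.
  by rewrite (_ : t2 = s2) //; apply/val_inj; rewrite /= e2 r20 add0r.
have [l [p1 [p2 [q1 [q2 [l0 Gp Gq h1 h2]]]]]] := radial_hull_step hr.
have s_ge0 (q s : {nonneg R}) : 0 <= q%:num + s%:num by rewrite addr_ge0.
apply: (@radial_hull_stepr _ _ _ _ l p1 p2 (NngNum (s_ge0 q1 s1)) (NngNum (s_ge0 q2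
  s2))) => //.
- by rewrite e1 h1 /= addrA.
- by rewrite e2 h2 /= addrA.
- by apply: (IHn q1 q2).
Qed.

(** The vertex pair, from which the hull starts, need not belong to [A]: the first
    step is a dilation. *)
Lemma radial_hull_sub (G0 A : set Y) n : G0 `<=` A ->
  (forall x1 x2 l (r1 r2 t1 t2 : {nonneg R}), 0 < l -> t1%:num = l * r1%:num ->
     t2%:num = l * r2%:num -> A (pair_pt x1 x2 r1 r2) -> A (pair_pt x1 x2 t1 t2)) ->
  (forall x1 x2 (r1 r2 s1 s2 t1 t2 : {nonneg R}), t1%:num = r1%:num + s1%:num ->
     t2%:num = r2%:num + s2%:num -> A (pair_pt x1 x2 r1 r2) -> A (pair_pt x1 x2 s1 s2) ->
     A (pair_pt x1 x2 t1 t2)) ->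
  radial_hull G0 n.+1 `<=` A.
Proof.
move=> GA Ascale Aadd; elim: n => [|n IHn] y; rewrite (pair_ptK y) => /radial_hull_step.
  move=> [l [r1 [r2 [s1 [s2 [l0 /GA Gr /radial_hull0E [s10 s20] h1 h2]]]]]].
  by apply: Ascale Gr; [exact: l0|rewrite h1 s10 addr0|rewrite h2 s20 addr0].
move=> [l [r1 [r2 [s1 [s2 [l0 /GA Gr /IHn As h1 h2]]]]]].
have r_ge0 (r : {nonneg R}) : 0 <= l * r%:num by rewrite mulr_ge0 // ltW.
apply: (Aadd _ _ (NngNum (r_ge0 r1)) (NngNum (r_ge0 r2)) s1 s2) => //.
exact: (Ascale _ _ l r1 r2).
Qed.

Lemma radial_hull_convex_cone G0 : radial_convex_cone (\bigcup_n radial_hull G0 n.+1).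
Proof.
pose Gamma := \bigcup_n radial_hull G0 n.+1.
have Gadd x1 x2 (r1 r2 s1 s2 t1 t2 : {nonneg R}) : t1%:num = r1%:num + s1%:num ->
     t2%:num = r2%:num + s2%:num -> Gamma (pair_pt x1 x2 r1 r2) ->
       Gamma (pair_pt x1 x2 s1 s2) ->
     Gamma (pair_pt x1 x2 t1 t2).
  move=> e1 e2 [n _ hr] [m _ hs]; exists (n + m).+1 => //.
  by rewrite -addnS -addSn; exact: radial_hull_add hr hs.
have Gscale x1 x2 l (r1 r2 t1 t2 : {nonneg R}) : 0 < l -> t1%:num = l * r1%:num ->
     t2%:num = l * r2%:num -> Gamma (pair_pt x1 x2 r1 r2) -> Gamma (pair_pt x1 x2 t1 t2).
  by move=> l0 e1 e2 [n _ hr]; exists n => //; apply: radial_hull_scale hr; eassumption.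
have scale_ge0 l (r : {nonneg R}) : 0 < l -> 0 <= l * r%:num.
  by move=> l0; rewrite mulr_ge0 // ltW.
move=> x1 x2.
have sec_scale (l : R) (r : R^o * R^o) : 0 < l -> radial_section Gamma x1 x2 r ->
    radial_section Gamma x1 x2 (l *: r).
  move=> l0 [[r1 r2] /= Gr <-].
  exists (NngNum (scale_ge0 l r1 l0), NngNum (scale_ge0 l r2 l0)) => //=.
  by apply: (Gscale _ _ l r1 r2).
have sec_add (r s : R^o * R^o) : radial_section Gamma x1 x2 r ->
    radial_section Gamma x1 x2 s -> radial_section Gamma x1 x2 (r + s).
  move=> [[r1 r2] /= Gr <-] [[s1 s2] /= Gs <-].
  have s_ge0 (q q' : {nonneg R}) : 0 <= q%:num + q'%:num by rewrite addr_ge0.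
  exists (NngNum (s_ge0 r1 s1), NngNum (s_ge0 r2 s2)) => //=.
  by apply: (Gadd _ _ r1 r2 s1 s2).
split; last by move=> l l0 r; exact: sec_scale.
apply/convex_setW => r s rG sG k k0 k1; apply/mem_set.
change (radial_section Gamma x1 x2 (k%:num *: (r : R^o * R^o) + (1 - k%:num) *: (s :
  R^o * R^o))).
apply: sec_add; first by apply: sec_scale => //; exact: set_mem.
apply: sec_scale; last exact: set_mem.
by rewrite subr_gt0.
Qed.

End hull.

Local Open Scope ereal_scope.

(** * Concentration on a sigma-compact cone *)

Lemma radon_exhaustion (R : realType) (T : ptopologicalType)
    (mu : {measure set borelType T -> \bar R}) (A : set T) :
  hausdorff_space T -> radon mu -> measurable (A : set (borelType T)) ->
  exists K : (set T)^nat, [/\ forall n, compact (K n), forall n, K n `<=` A,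
    forall n m, (n <= m)%N -> K n `<=` K m & mu (A `\` \bigcup_n K n) = 0].
Proof.
move=> hT rmu mA.
have [K hK] : {K : nat -> set T & forall n,
    [/\ compact (K n), K n `<=` A & mu (A `\` K n) <= (n.+1%:R^-1)%:E]}.
  apply: (@choice _ _ (fun n K => [/\ compact K,
    K `<=` A & mu (A `\` K) <= (n.+1%:R^-1)%:E])) => n.
  by apply: rmu => //; rewrite invr_gt0.
pose K' n := \big[setU/set0]_(i < n.+1) K i.
have KK' n : K n `<=` K' n by move=> y Ky; rewrite /K' big_ord_recr /=; right.
have K'E n y : K' n y -> exists2 i, (i <= n)%N & K i y.
  by rewrite /K' -bigcup_mkord => -[i /= ii Ky]; exists i.
have cK' n : compact (K' n).
  by apply: bigsetU_compact => i _; have [] := hK i.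
exists K'; split=> //.
- by move=> n y /K'E[i _ Ky]; have [_ + _] := hK i; apply.
- move=> n m nm y /K'E[i ii Ky]; rewrite /K' -bigcup_mkord; exists i => //=.
  by rewrite ltnS (leq_trans ii).
have mU : measurable (A `\` \bigcup_n K' n : set (borelType T)).
  apply: measurableD => //; apply: bigcupT_measurable => n; exact: compact_borel.
apply/eqP; rewrite eq_le measure_ge0 andbT; apply/lee_addgt0Pr => e e0; rewrite add0e.
have [n ne] : exists n, (n.+1%:R^-1 <= e)%R.
  exists (Num.truncn e^-1); rewrite invf_ple ?posrE //; exact/ltW/truncnS_gt.
have [cKn _ hn] := hK n.
apply: (@le_trans _ _ (mu (A `\` K n))); last by apply: (le_trans hn); rewrite lee_fin.
apply: le_measure; rewrite ?inE //.
  by apply: measurableD => //; exact: compact_borel.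
by move=> y [Ay nK]; split=> // Ky; apply: nK; exists n => //; exact: KK'.
Qed.

Section vanishing_marginal.
Variables (R : realType) (X T : ptopologicalType) (p : T -> cone R X).
Hypothesis cp : continuous p.
Variable alpha : {measure set borelType T -> \bar R}.

Lemma null_marginal_negligible (N : set X) : measurable (N : set (borelType X)) ->
  \int[alpha]_(y in [set y | (0 < rad (p y))%R /\ N (cone_base (p y))]) (rad (p y))%:E
    = 0 ->
  alpha.-negligible [set y | (0 < rad (p y))%R /\ N (cone_base (p y))].
Proof.
move=> mN; rewrite marginal_densityE => I0.
have mm := marginal_density_measurable cp mN.
have : ae_eq alpha setT (EFin \o marginal_density p N) (cst 0).
  apply/(ae_eq_integral_abs alpha measurableT mm).
  rewrite -[RHS]I0; apply: eq_integral => y _ /=.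
  by rewrite ger0_norm // marginal_density_ge0.
apply: negligibleS => y /= [r0 Ny] /(_ I) /eqP; rewrite eqe.
by rewrite /marginal_density indicE mem_set // mul1r gt_eqF.
Qed.

End vanishing_marginal.
Section eventual_calibration.
Variables (R : realType) (X1 X2 : ptopologicalType).
Let Y : ptopologicalType := (cone R X1 * cone R X2)%type.
Variable H : Y -> \bar R.
Variables (B1 : (set X1)^nat) (B2 : (set X2)^nat).
Variables (phi1 : nat -> nat -> X1 -> R) (phi2 : nat -> nat -> X2 -> R).

(** Membership in all [calibrated] sets from some rank on lets finitely many
    pairs be handled by the same potentials. *)
Definition eventually_calibrated : set Y := [set y | exists M, forall m,
  (M <= m)%N -> calibrated H (B1 m) (B2 m) (phi1 m) (phi2 m) y].

Hypothesis H_ge0 : forall y, 0 <= H y.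
Hypothesis H_hom : radially_homogeneous H.
Hypothesis H_convex : radially_convex H.
Hypothesis phi_le : forall m n y, cone_product (B1 m) (B2 m) y ->
  (potential (phi1 m n) (phi2 m n) y)%:E <= H y.

Lemma eventually_calibrated_scale x1 x2 l (r1 r2 t1 t2 : {nonneg R}) :
  (0 < l)%R -> (t1%:num = l * r1%:num)%R -> (t2%:num = l * r2%:num)%R ->
  eventually_calibrated (cone_pt x1 r1, cone_pt x2 r2) ->
  eventually_calibrated (cone_pt x1 t1, cone_pt x2 t2).
Proof.
move=> l0 e1 e2 [M hM]; exists M => m /hM.
by apply: (calibrated_scale H_ge0 H_hom l0).
Qed.

Lemma eventually_calibrated_add x1 x2 (r1 r2 s1 s2 t1 t2 : {nonneg R}) :
  (t1%:num = r1%:num + s1%:num)%R -> (t2%:num = r2%:num + s2%:num)%R ->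
  eventually_calibrated (cone_pt x1 r1, cone_pt x2 r2) ->
  eventually_calibrated (cone_pt x1 s1, cone_pt x2 s2) ->
  eventually_calibrated (cone_pt x1 t1, cone_pt x2 t2).
Proof.
move=> e1 e2 [M hM] [M' hM']; exists (maxn M M') => m.
rewrite geq_max => /andP[/hM h /hM' h'].
exact: (calibrated_add H_ge0 H_hom H_convex e1 e2 h h').
Qed.

Lemma eventually_calibrated_monotone :
  cyclically_monotone H eventually_calibrated.
Proof.
move=> N y s /choice[M hM].
pose m := \max_(i < N) M i.
apply: (@calibrated_monotone _ _ _ H H_ge0 (B1 m) (B2 m) (phi1 m) (phi2 m)).
  by move=> n y'; exact: phi_le.
by move=> i; apply: hM; rewrite /m (bigD1 i) //= leq_maxl.
Qed.

End eventual_calibration.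

Section concentration.
Variables (R : realType) (X1 X2 : ptopologicalType).
Let Y : ptopologicalType := (cone R X1 * cone R X2)%type.
Hypotheses (hX1 : hausdorff_space X1) (hX2 : hausdorff_space X2).
Variable alpha : {finite_measure set borelType Y -> \bar R}.
Hypothesis alpha_radon : radon alpha.

(** The compact sets given by inner regularity are cut by sets of pairs with
    compact bases and bounded radii before the convex cone hull is taken. *)
Lemma concentrated_sigma_compact_cone (A : set Y)
    (B1 : (set X1)^nat) (B2 : (set X2)^nat) :
  (forall m, compact (B1 m)) -> (forall m, compact (B2 m)) ->
  (forall y, A y -> exists M, forall m, (M <= m)%N ->
    cone_product (B1 m) (B2 m) y) ->
  (forall x1 x2 l (r1 r2 t1 t2 : {nonneg R}), (0 < l)%R ->
     (t1%:num = l * r1%:num)%R -> (t2%:num = l * r2%:num)%R ->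
     A (cone_pt x1 r1, cone_pt x2 r2) -> A (cone_pt x1 t1, cone_pt x2 t2)) ->
  (forall x1 x2 (r1 r2 s1 s2 t1 t2 : {nonneg R}),
     (t1%:num = r1%:num + s1%:num)%R -> (t2%:num = r2%:num + s2%:num)%R ->
     A (cone_pt x1 r1, cone_pt x2 r2) -> A (cone_pt x1 s1, cone_pt x2 s2) ->
     A (cone_pt x1 t1, cone_pt x2 t2)) ->
  alpha.-negligible (~` A) ->
  exists Gamma : set Y, [/\ Gamma `<=` A, sigma_compact Gamma,
    radial_convex_cone Gamma & concentrated alpha Gamma].
Proof.
move=> cB1 cB2 AW Ascale Aadd [N [mN N0 AN]].
have hY : hausdorff_space Y by exact: cone_pair_hausdorff.
have mNC : measurable (~` N : set (borelType Y)) by exact: measurableC.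
have NA : ~` N `<=` A by move=> y nN; apply: contrapT => /AN.
have [K [cK KN _ nK]] := radon_exhaustion hY alpha_radon mNC.
pose W m : set Y := cone_product (B1 m) (B2 m).
pose V m : set Y := [set y | rad y.1 <= m%:R /\ rad y.2 <= m%:R]%R.
have clW m : closed (W m) by exact: cone_product_closed.
have clV m : closed (V m).
  apply: closedI.
    apply: (@closed_comp _ _ (fun y : Y => rad y.1) [set s | s <= m%:R]%R).
      by move=> y _; exact: rad1_continuous.
    exact: closed_le.
  apply: (@closed_comp _ _ (fun y : Y => rad y.2) [set s | s <= m%:R]%R).
    by move=> y _; exact: rad2_continuous.
  exact: closed_le.
pose G0 : set Y := \bigcup_(i : nat * nat) (K i.1 `&` (W i.2 `&` V i.2)).
have sG0 : sigma_bounded_compact G0.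
  apply: sigma_bounded_compact_bigcup => -[n m] /=; split.
    apply: compact_closedI; first exact: cK.
    by apply: closedI; [exact: clW|exact: clV].
  by exists (B1 m), (B2 m), (m%:R)%R; split=> // y [].
have KG0 : \bigcup_n K n `<=` G0.
  move=> y [n _ Ky]; have [M hM] := AW _ (NA _ (KN n _ Ky)).
  pose m := maxn M (maxn (Num.truncn (rad y.1)).+1 (Num.truncn (rad y.2)).+1).
  exists (n, m) => //; split=> //; split; first exact: hM (leq_maxl _ _).
  by split=> /=; apply: le_trans (ltW (truncnS_gt _)) _;
    rewrite ler_nat /m !leq_max leqnn ?orbT.
have G0A : G0 `<=` A by move=> y [[n m] _ [/KN Ky _]]; exact: NA.
pose Gamma : set Y := \bigcup_n radial_hull G0 n.+1.
have G0Gamma : G0 `<=` Gamma.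
  move=> y Gy; exists 0%N => //; rewrite (pair_ptK y).
  apply: (@radial_hull_stepr _ _ _ _ _ _ _ 1%R (cone_radius y.1)
    (cone_radius y.2) 0%:nng%R 0%:nng%R).
  - exact: ltr01.
  - by rewrite /= mul1r addr0.
  - by rewrite /= mul1r addr0.
  - by rewrite -pair_ptK.
  - by congr pair; exact: cone_pt0.
have scGamma : sigma_compact Gamma.
  have [L hL] : {L : nat -> nat -> set Y & forall n,
      (forall i, bounded_compact (L n i)) /\
      radial_hull G0 n.+1 = \bigcup_i L n i}.
    apply: (@choice _ _ (fun n L => (forall i, bounded_compact (L i)) /\
      radial_hull G0 n.+1 = \bigcup_i L i)) => n.
    have [L cL eL] := sigma_radial_hull hX1 hX2 n.+1 sG0.
    by exists L.
  have -> : Gamma = \bigcup_(i : nat * nat) L i.1 i.2.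
    apply/seteqP; split=> y.
      by move=> [n _]; rewrite (hL n).2 => -[i _ Ly]; exists (n, i).
    by move=> [[n i] _ Ly]; exists n => //; rewrite (hL n).2; exists i.
  have [|L' cL' ->] := @sigma_bounded_compact_bigcup R X1 X2 _
    (fun i : nat * nat => L i.1 i.2); first by move=> i; exact: (hL i.1).1.
  by exists L' => // n; have [] := cL' n.
exists Gamma; split=> //.
- by move=> y [n _]; exact: (radial_hull_sub G0A Ascale Aadd).
- exact: radial_hull_convex_cone.
- split; first exact: sigma_compact_borel.
  have mK : measurable (~` N `\` \bigcup_n K n : set (borelType Y)).
    apply: measurableD => //; apply: bigcupT_measurable => n.
    exact: compact_borel.
  have neg : alpha.-negligible (~` N `\` \bigcup_n K n).
    by exists (~` N `\` \bigcup_n K n); split.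
  have negN : alpha.-negligible N by exists N; split.
  apply: negligibleS (negligibleU negN neg) => y nGy.
  have [Ny|nNy] := pselect (N y); [by left|right; split=> // Ky].
  by apply/nGy/G0Gamma/KG0.
Qed.

End concentration.

Section calibration_of_optimal_plans.
Variables (R : realType) (X1 X2 : ptopologicalType).
Let Y : ptopologicalType := (cone R X1 * cone R X2)%type.
Hypotheses (hX1 : hausdorff_space X1) (hX2 : hausdorff_space X2).
Variable H : Y -> \bar R.
Hypothesis H_ge0 : forall y, 0 <= H y.
Hypothesis H_hom : radially_homogeneous H.
Hypothesis H_lsc : lower_semicontinuous H.
Variable mu1 : {finite_measure set borelType X1 -> \bar R}.
Variable mu2 : {finite_measure set borelType X2 -> \bar R}.
Hypotheses (mu1_radon : radon mu1) (mu2_radon : radon mu2).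
Variable alpha : {finite_measure set borelType Y -> \bar R}.
Hypothesis alpha_plan : homogeneous_plan mu1 mu2 alpha.
Hypothesis alpha_optimal : \int[alpha]_y H y = transport_cost H mu1 mu2.
Hypothesis alpha_finite : \int[alpha]_y H y < +oo.

Let unexhausted_negligible (X : ptopologicalType) (p : Y -> cone R X)
    (mu : {finite_measure set borelType X -> \bar R}) (B : (set X)^nat) :
  continuous p -> hausdorff_space X -> (forall n, compact (B n)) ->
  mu (setT `\` \bigcup_n B n) = 0 ->
  (forall A, measurable (A : set (borelType X)) -> mu A = \int[alpha]_(y in
    [set y | (0 < rad (p y))%R /\ A (cone_base (p y))]) (rad (p y))%:E) ->
  alpha.-negligible [set y | forall n, ~ cone_over (B n) (p y)].
Proof.
move=> cp hX cB B0 muE.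
have mU : measurable (setT `\` \bigcup_n B n : set (borelType X)).
  apply: measurableD => //; apply: bigcupT_measurable => n.
  exact: compact_borel.
have := @null_marginal_negligible R X Y p cp alpha _ mU
  (etrans (esym (muE _ mU)) B0).
apply: negligibleS => y nB; split.
  by apply: cone_rad_gt0 => r0; apply: (nB 0%N); left.
by split=> // -[n _ Bn]; apply: (nB n); right.
Qed.

(** The compact sets exhaust the marginals, so almost every pair is over [B1 m]
    and [B2 m] for all large [m], and then it is calibrated for these [m] unless
    it belongs to one of countably many negligible sets. *)
Lemma calibrating_potentials : exists B1 B2 phi1 phi2, [/\
  forall m, compact (B1 m), forall m, compact (B2 m),
  forall m n y, cone_product (B1 m) (B2 m) y ->
    (potential (phi1 m n) (phi2 m n) y)%:E <= H y &
  alpha.-negligible (~` eventually_calibrated H B1 B2 phi1 phi2)].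
Proof.
have [ra fa m1E m2E] := alpha_plan.
have [B1 [cB1 _ incB1 nB1]] := radon_exhaustion hX1 mu1_radon measurableT.
have [B2 [cB2 _ incB2 nB2]] := radon_exhaustion hX2 mu2_radon measurableT.
pose W m : set Y := cone_product (B1 m) (B2 m).
have mW m : measurable (W m : set (borelType Y)).
  by apply: closed_borel; exact: cone_product_closed.
have pot m n : exists phi : (X1 -> R) * (X2 -> R),
   [/\ alpha.-integrable (W m) (EFin \o potential phi.1 phi.2),
   forall y, W m y -> (potential phi.1 phi.2 y)%:E <= H y &
   \int[alpha]_(y in W m) H y <=
     (\int[alpha]_(y in W m) potential phi.1 phi.2 y)%R%:E +
     (2^-1 ^+ n.+1)%:E].
  have e0 : (0 < 2^-1 ^+ n.+1 :> R)%R by rewrite exprn_gt0 // invr_gt0.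
  have [phi1 [phi2 [i1 i2 hle happ]]] := optimal_potentials hX1 hX2 H_ge0 H_hom
    H_lsc mu1_radon mu2_radon alpha_plan alpha_optimal alpha_finite
    (cB1 m) (cB2 m) e0.
  exists (phi1, phi2); split=> //.
  by apply: eq_integrable (integrableD (mW m) i1 i2).
have [phi hphi] := @choice _ _ _ (fun mn : nat * nat => pot mn.1 mn.2).
pose phi1 m n := (phi (m, n)).1; pose phi2 m n := (phi (m, n)).2.
have neg m : alpha.-negligible
    (W m `\` calibrated H (B1 m) (B2 m) (phi1 m) (phi2 m)).
  apply: calibrated_negligible => //.
  - exact: mW.
  - apply: le_lt_trans alpha_finite.
    rewrite (ge0_integral_setTD alpha (mW m)) //; last exact: lsc_borel.
    by rewrite leeDl // integral_ge0.
  - by move=> n; have [] := hphi (m, n).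
  - by move=> n; have [] := hphi (m, n).
  - by move=> n; have [] := hphi (m, n).
exists B1, B2, phi1, phi2; split=> //.
  by move=> m n y; have [_ h _] := hphi (m, n); exact: h.
have neg1 := unexhausted_negligible (@fst_continuous R X1 X2) hX1 cB1 nB1 m1E.
have neg2 := unexhausted_negligible (@snd_continuous R X1 X2) hX2 cB2 nB2 m2E.
apply: negligibleS (negligibleU (negligibleU neg1 neg2) (negligible_bigcup neg)).
move=> y nA; apply: contrapT => /not_orP[/not_orP[n1 n2] n3]; apply: nA.
have [m1 hm1] : exists m, cone_over (B1 m) y.1.
  by apply: contrapT => /forallNP nB; exact: n1.
have [m2 hm2] : exists m, cone_over (B2 m) y.2.
  by apply: contrapT => /forallNP nB; exact: n2.
exists (maxn m1 m2) => m; rewrite geq_max => /andP[m1m m2m].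
apply: contrapT => nG; apply: n3; exists m => //; split=> //; split.
  by case: hm1 => [|h]; [left|right; exact: incB1 h].
by case: hm2 => [|h]; [left|right; exact: incB2 h].
Qed.

End calibration_of_optimal_plans.

Theorem proposition2 (R : realType) (X1 X2 : ptopologicalType)
  (X1_hausdorff : hausdorff_space X1)
  (X1_creg : completely_regular_space X1)
  (X2_hausdorff : hausdorff_space X2)
  (X2_creg : completely_regular_space X2)
  (H : cone R X1 * cone R X2 -> \bar R)
  (H_ge0 : forall y, 0 <= H y)
  (H_proper : proper_cost H)
  (H_hom : radially_homogeneous H)
  (H_convex : radially_convex H)
  (H_lsc : lower_semicontinuous H)
  (mu1 : {finite_measure set borelType X1 -> \bar R}) (mu1_radon : radon mu1)
  (mu2 : {finite_measure set borelType X2 -> \bar R}) (mu2_radon : radon mu2)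
  (alpha : {finite_measure set borelType (cone R X1 * cone R X2)%type
            -> \bar R})
  (alpha_plan : homogeneous_plan mu1 mu2 alpha)
  (alpha_optimal : \int[alpha]_y H y = transport_cost H mu1 mu2)
  (alpha_finite : \int[alpha]_y H y < +oo) :
  exists Gamma : set (cone R X1 * cone R X2),
    [/\ sigma_compact Gamma, radial_convex_cone Gamma,
        cyclically_monotone H Gamma & concentrated alpha Gamma].
Proof.
have [B1 [B2 [phi1 [phi2 [cB1 cB2 phi_le neg]]]]] := calibrating_potentials
  X1_hausdorff X2_hausdorff H_ge0 H_hom H_lsc mu1_radon mu2_radon alpha_plan
  alpha_optimal alpha_finite.
have [ra _ _ _] := alpha_plan.
have [|||Gamma [GA sG cG aG]] := concentrated_sigma_compact_cone X1_hausdorff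
  X2_hausdorff ra cB1 cB2 _ _ _ neg.
- by move=> y [M hM]; exists M => m /hM[].
- exact: eventually_calibrated_scale.
- exact: eventually_calibrated_add.
exists Gamma; split=> // N y s Gy.
by apply: (eventually_calibrated_monotone H_ge0 phi_le) => i; exact: GA.
Qed.
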